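(* Under the stated assumptions, \begin{displaymath} \begin{split} & \prod_{r=1}^{k_3}\left|\frac{\zeta\left(\frac 12+i\alpha_r^{3,3}\right)}{\zeta\left(\frac 12+i\beta_r^3\right)}\right|^2\sim \frac{\cos^2(\alpha_0^{2,2})\cos^2(\alpha_0^{3,3})}{\cos(2\mu +U)\cos(\mu+U)\cos\mu} \prod_{r=1}^{k_2}\left|\frac{\zeta\left(\frac 12+i\alpha_r^{2,2}\right)}{\zeta\left(\frac 12+i\beta_r^2\right)}\right|^2- \\ & -\frac{\sin^2(\alpha_0^{1,1})\cos^2(\alpha_0^{3,3})}{\cos(2\mu +U)\cos(\mu+U)\cos\mu} \prod_{r=1}^{k_1}\left|\frac{\zeta\left(\frac 12+i\alpha_r^{1,1}\right)}{\zeta\left(\frac 12+i\beta_r^1\right)}\right|^2,\ L\to\infty , \end{split} \end{displaymath} where $\alpha_r^{3,3}=\alpha_r(U,\mu,L,k_3;1/\cos^2t)$, $\beta_r^3=\beta_r(U,\mu,L,k_3)$, $\alpha_r^{1,1}=\alpha_r(U,\mu,L,k_1;\sin^2t)$, $\beta_r^1=\beta_r(U,\mu,L,k_1)$, $\alpha_r^{2,2}=\alpha_r(U,\mu,L,k_2;\cos^2t)$, $\beta_r^2=\beta_r(U,\mu,L,k_2)$, $1\le k_1,k_2,k_3\le k_0$.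
   Context: Jacob's ladder: $\varphi_1(t)=\frac12\varphi(t)$, where $\varphi$ is an arbitrary solution of $\int_0^{\mu[x(T)]}Z^2(t)e^{-\frac{2}{x(T)}t}dt=\int_0^TZ^2(t)dt$ ($\mu(y)>7y\ln y$), with $Z(t)=e^{i\vartheta(t)}\zeta(\frac12+it)$. Put $\tilde Z^2(t)=|\zeta(\frac12+it)|^2/\omega(t)$, $\omega(t)=\{1+O(\ln\ln t/\ln t)\}\ln t$. For $T>T_0$, $U\in(0,U_0]$, $U_0=o(T/\ln T)$, and $f$ continuous and positive on $[T,T+U]$, define reverse iterations $T^{(k)}$ by $\varphi_1(T^{(k)})=T^{(k-1)}$, $T^{(0)}=T$ (likewise $(T+U)^{(k)}$). Then $\int_{T^{(k)}}^{(T+U)^{(k)}}f[\varphi_1^k(t)]\prod_{r=0}^{k-1}\tilde Z^2[\varphi_1^r(t)]dt=\int_T^{T+U}f(t)dt$; by the mean-value theorem choose $d$ with $f(\alpha_0)\prod_{r=1}^k\tilde Z^2(\alpha_r)=\frac{U}{(T+U)^{(k)}-T^{(k)}}H(T,U;f)$, $\alpha_r=\varphi_1^{k-r}(d)$, and $e$ with $\prod_{r=1}^k\tilde Z^2(\beta_r)=\frac{U}{(T+U)^{(k)}-T^{(k)}}$, $\beta_r=\varphi_1^{k-r}(e)$, where $H(T,U;f)=\frac1U\int_T^{T+U}f$. Assumptions: $T=\pi L+\mu$, $L\in\mathbb{N}$, $U\in(0,U_0]$, $\mu\ge\mu_0>0$, $2\mu+U_0\le\frac{\pi}{2}-\epsilon$,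 $\epsilon>0$, $\pi L>T_0$. *)

(* Defs.v *)
From Stdlib Require Import Reals Lra.
From Coquelicot Require Import Coquelicot.
Open Scope R_scope.

(* Dirichlet eta function on the critical line, s = 1/2 + i t:
   eta(s) = sum_{n>=1} (-1)^(n-1) n^(-s),
   n^(-1/2 - i t) = n^(-1/2) (cos(t ln n) - i sin(t ln n)). *)
Definition eta_re (t : R) : R :=
  Series (fun n => (-1) ^ n / sqrt (INR (S n)) * cos (t * ln (INR (S n)))).
Definition eta_im (t : R) : R :=
  - Series (fun n => (-1) ^ n / sqrt (INR (S n)) * sin (t * ln (INR (S n)))).

(* zeta(s) = eta(s) / (1 - 2^(1-s)); for s = 1/2 + i t,
   |1 - 2^(1-s)|^2 = 3 - 2 sqrt 2 cos(t ln 2) > 0.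
   zeta_abs2 t = |zeta(1/2 + i t)|^2  ( = Z^2(t) ). *)
Definition zeta_abs2 (t : R) : R :=
  (eta_re t ^ 2 + eta_im t ^ 2) / (3 - 2 * sqrt 2 * cos (t * ln 2)).

Fixpoint iterf (n : nat) (g : R -> R) (x : R) : R :=
  match n with
  | O => x
  | S m => g (iterf m g x)
  end.

Fixpoint prod1 (k : nat) (a : nat -> R) : R :=
  match k with
  | O => 1
  | S m => prod1 m a * a (S m)
  end.

Definition Hmean (T U : R) (f : R -> R) : R := / U * RInt f T (T + U).

Definition Zt2 (omega : R -> R) (t : R) : R := zeta_abs2 t / omega t.

(* alpha_r = phi_1^{k-r}(d) (same formula for beta_r with e) *)
Definition alpha (phi1 : R -> R) (k : nat) (d : R) (r : nat) : R :=
  iterf (k - r) phi1 d.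

Definition jacob_eq (mu_fun : R -> R) (phi : R -> R) (T : R) : Prop :=
  RInt (fun t => zeta_abs2 t * exp (- (2 / phi T) * t)) 0 (mu_fun (phi T))
  = RInt zeta_abs2 0 T.

Definition fsin2 (t : R) : R := sin t ^ 2.
Definition fcos2 (t : R) : R := cos t ^ 2.
Definition finvcos2 (t : R) : R := 1 / cos t ^ 2.

(* Main.v *)
Require Import Defs.
From Stdlib Require Import Reals Lra Lia.
From Coquelicot Require Import Coquelicot.
Open Scope R_scope.

(** Dividing the two mean-value identities leaves
    [f(alpha_0) prod |zeta(alpha_r) / zeta(beta_r)|^2 = H(f) prod omega(alpha_r) / omega(beta_r)].
    Since [H(cos^2) - H(sin^2) = cos (2 mu + U) sin U / U] and
    [H(1/cos^2) = sin U / (U cos (mu + U) cos mu)] do not depend on [L], it suffices that each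
    [omega(alpha_r) / omega(beta_r)] tends to 1, for which it is enough that
    [(T+U)^(r) - T^(r) <= T^(r)] and [T^(r) -> oo].

    This needs only a lower bound for the second moment of zeta on the intervals [x, x + x^eps],
    valid for every [eps > 0].  Write [Re eta = 1 - D] on the critical line, so that
    [(Re eta)^2 >= 1 - 2 D].  The [k]-fold primitive of [D], with frequencies [ln n], is the
    alternating series with an additional factor [(ln n)^(-k)], hence still [O(1 + |t|)].
    Averaging [k] times over windows of length [h] therefore leaves [h^k - O(x)], a positive
    quantity as soon as [h^k] exceeds a multiple of [x].  As [phi_1' = |zeta|^2 / omega], a gap
    [(T+U)^(r) - T^(r)] below every power of [T^(r)] then forces the same of the next one. *)

(** * The alternating series for eta and its iterated primitives *)

(** A Leibniz test that does not ask [g] to be monotone: pairing half of each term with half of its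
    neighbour leaves half-differences, and their bounds [v n - v (S n)] telescope. *)
Lemma alternating_sum_bound (g v : nat -> R) (M N : nat) :
  (forall n, Rabs (g n) <= v n) ->
  (forall n, Rabs (g n - g (S n)) <= v n - v (S n)) ->
  Rabs (sum_n_m (fun n => (-1) ^ n * g n) N (N + M)) <= v N.
Proof.
  assert (Rabs_half : forall x, Rabs (x / 2) = Rabs x / 2)
    by (intros x; rewrite Rabs_div, (Rabs_pos_eq 2); lra).
  intros Hg Hd.
  (* An alternating sum stays within half the majorant of half its first term. *)
  assert (H : Rabs (sum_n_m (fun n => (-1) ^ n * g n) N (N + M)
                    - (-1) ^ N * g N / 2) <= v N / 2).
  { revert N; induction M as [|M IH]; intros N.
    - rewrite Nat.add_0_r, sum_n_n.
      replace ((-1) ^ N * g N - (-1) ^ N * g N / 2) with ((-1) ^ N * (g N / 2)) by field.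
      rewrite Rabs_mult, pow_1_abs, Rmult_1_l.
      rewrite Rabs_half. specialize (Hg N); lra.
    - rewrite sum_Sn_m by lia.
      replace (N + S M)%nat with (S N + M)%nat by lia.
      specialize (IH (S N)); specialize (Hd N).
      change plus with Rplus.
      set (s := sum_n_m _ _ _) in *.
      replace (_ - _) with
        ((s - (-1) ^ S N * g (S N) / 2) + (-1) ^ N * ((g N - g (S N)) / 2))
        by (simpl; field).
      eapply Rle_trans; [apply Rabs_triang|].
      rewrite Rabs_mult, pow_1_abs, Rmult_1_l.
      rewrite Rabs_half. lra. }
  replace (sum_n_m _ _ _) with
    ((sum_n_m (fun n => (-1) ^ n * g n) N (N + M) - (-1) ^ N * g N / 2)
     + (-1) ^ N * (g N / 2)) by field.
  eapply Rle_trans; [apply Rabs_triang|].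
  rewrite (Rabs_mult _ (g N / 2)), pow_1_abs, Rmult_1_l.
  rewrite Rabs_half. specialize (Hg N); lra.
Qed.

(* With [x = ln n] this is [n^(-1/2) (ln n)^(-k) cos (t ln n - c)]: the
   real or imaginary part of the terms of [eta] integrated [k] times. *)
Definition osc (k : nat) (c t x : R) : R :=
  exp (- x / 2) * (/ x) ^ k * cos (t * x - c).

(** Twice the sum of [2^k / 2], [4 k 2^k] and [2^k |t|], the bounds for the three terms of the
    derivative of [osc] in [x], apart from the factor [exp (- x / 2)], when [x >= 1/2]. All
    frequencies [ln n] with [n >= 2] lie in that range. *)
Definition osc_const (k : nat) (t : R) : R := 2 ^ k * (1 + 8 * INR k + 2 * Rabs t).

Lemma osc_const_pos (k : nat) (t : R) : 2 ^ k <= osc_const k t.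
Proof.
  unfold osc_const. assert (0 < 2 ^ k) by (apply pow_lt; lra).
  pose proof (pos_INR k); pose proof (Rabs_pos t). nra.
Qed.

Lemma inv_pow_bound (k : nat) (x : R) : / 2 <= x -> 0 < (/ x) ^ k <= 2 ^ k.
Proof.
  intros Hx. assert (0 < / x) by (apply Rinv_0_lt_compat; lra).
  split; [now apply pow_lt|].
  apply pow_incr; split; [lra|]. rewrite <- (Rinv_inv 2).
  apply Rinv_le_contravar; lra.
Qed.

Lemma osc_bound (k : nat) (c t x : R) :
  / 2 <= x -> Rabs (osc k c t x) <= osc_const k t * exp (- x / 2).
Proof.
  intros Hx. unfold osc. rewrite !Rabs_mult.
  pose proof (inv_pow_bound k x Hx). pose proof (exp_pos (- x / 2)).
  pose proof (osc_const_pos k t).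
  rewrite (Rabs_pos_eq (exp _)), (Rabs_pos_eq (_ ^ k)) by lra.
  assert (Rabs (cos (t * x - c)) <= 1) by (apply Rabs_le, COS_bound).
  apply Rle_trans with (exp (- x / 2) * (/ x) ^ k * 1); [|nra].
  apply Rmult_le_compat_l; [nra|assumption].
Qed.

(** The slope of [osc] is dominated by that of the majorant [osc_const k t * exp (- x / 2)], so the
    decrease of the majorant controls the variation of [osc]. This supplies the second premise of
    [alternating_sum_bound]. *)
Lemma osc_variation (k : nat) (c t x y : R) :
  / 2 <= x <= y ->
  Rabs (osc k c t x - osc k c t y)
  <= osc_const k t * exp (- x / 2) - osc_const k t * exp (- y / 2).
Proof.
  intros [Hx Hxy].
  (* The derivative of [osc k c t]. The product [(/ z) ^ 2 * (/ z) ^ pred k] stands for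
     [(/ z) ^ (k + 1)]; at [k = 0] they differ, but the factor [INR k] vanishes. *)
  set (dosc := fun z => exp (- z / 2) *
    (- / 2 * (/ z) ^ k * cos (t * z - c)
     - INR k * (/ z) ^ 2 * (/ z) ^ pred k * cos (t * z - c)
     - (/ z) ^ k * t * sin (t * z - c))).
  assert (Hder : forall z, x <= z -> is_derive (osc k c t) z (dosc z)).
  { intros z Hz. unfold osc, dosc. auto_derive; [lra|]. unfold Rdiv, Rminus.
    generalize ((/ z) ^ k) ((/ z) ^ pred k); intros p q; simpl. field. lra. }
  assert (Hdb : forall z, x <= z -> Rabs (dosc z) <= osc_const k t * exp (- z / 2) / 2).
  { intros z Hz. unfold dosc. rewrite Rabs_mult, (Rabs_pos_eq (exp _))
      by (left; apply exp_pos).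
    pose proof (exp_pos (- z / 2)).
    enough (Rabs (- / 2 * (/ z) ^ k * cos (t * z - c)
     - INR k * (/ z) ^ 2 * (/ z) ^ pred k * cos (t * z - c)
     - (/ z) ^ k * t * sin (t * z - c)) <= osc_const k t / 2) by nra.
    assert (Hc : Rabs (cos (t * z - c)) <= 1) by (apply Rabs_le, COS_bound).
    assert (Hs : Rabs (sin (t * z - c)) <= 1) by (apply Rabs_le, SIN_bound).
    assert (Hz2 : / 2 <= z) by lra.
    pose proof (inv_pow_bound k z Hz2) as Hk.
    pose proof (inv_pow_bound 2 z Hz2) as H2.
    pose proof (inv_pow_bound (pred k) z Hz2) as Hp.
    assert (Hpk : 2 ^ pred k <= 2 ^ k) by (apply Rle_pow; [lra|lia]).
    assert (0 < 2 ^ k) by (apply pow_lt; lra).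
    pose proof (pos_INR k) as Hk0.
    assert (A1 : Rabs (- / 2 * (/ z) ^ k * cos (t * z - c)) <= 2 ^ k / 2).
    { rewrite !Rabs_mult, Rabs_Ropp, (Rabs_pos_eq (/ 2)), (Rabs_pos_eq (_ ^ k)) by lra.
      pose proof (Rabs_pos (cos (t * z - c))). nra. }
    assert (A2 : Rabs (INR k * (/ z) ^ 2 * (/ z) ^ pred k * cos (t * z - c))
                 <= 4 * INR k * 2 ^ k).
    { rewrite !Rabs_mult, (Rabs_pos_eq (INR k)), (Rabs_pos_eq (_ ^ 2)),
        (Rabs_pos_eq (_ ^ pred k)) by lra.
      replace (4 * INR k * 2 ^ k) with (INR k * 2 ^ 2 * 2 ^ k * 1) by ring.
      apply Rmult_le_compat; [|apply Rabs_pos| |exact Hc].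
      - apply Rmult_le_pos; [apply Rmult_le_pos|]; lra.
      - apply Rmult_le_compat; try lra; [apply Rmult_le_pos; lra|].
        apply Rmult_le_compat_l; lra. }
    assert (A3 : Rabs ((/ z) ^ k * t * sin (t * z - c)) <= 2 ^ k * Rabs t).
    { rewrite !Rabs_mult, (Rabs_pos_eq (_ ^ k)) by lra.
      pose proof (Rabs_pos t).
      rewrite <- (Rmult_1_r (2 ^ k * Rabs t)).
      apply Rmult_le_compat; [nra|apply Rabs_pos|nra|exact Hs]. }
    apply Rabs_le_between in A1, A2, A3. apply Rabs_le. unfold osc_const.
    revert A1 A2 A3. generalize (- / 2 * (/ z) ^ k * cos (t * z - c))
      (INR k * (/ z) ^ 2 * (/ z) ^ pred k * cos (t * z - c))
      ((/ z) ^ k * t * sin (t * z - c)) (2 ^ k); intros; lra. }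
  set (K := osc_const k t) in *.
  (* Both [K e^(-x/2) + osc] and [K e^(-x/2) - osc] decrease. *)
  assert (Hmon : forall s, s = 1 \/ s = -1 ->
     K * exp (- y / 2) + s * osc k c t y <= K * exp (- x / 2) + s * osc k c t x).
  { intros s Hs.
    destruct (MVT_gen (fun z => K * exp (- z / 2) + s * osc k c t z) x y
      (fun z => - (K * exp (- z / 2) / 2) + s * dosc z)) as [z [Hz Heq]].
    - intros z; rewrite Rmin_left, Rmax_right by lra; intros Hz.
      assert (D := Hder z ltac:(lra)).
      apply (is_derive_plus (fun z => K * exp (- z / 2)) (fun z => s * osc k c t z)).
      + auto_derive; [trivial|]. unfold Rdiv. field.
      + apply (is_derive_scal (osc k c t) z s), D.
    - intros z; rewrite Rmin_left, Rmax_right by lra; intros Hz.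
      apply derivable_continuous_pt, ex_derive_Reals_0.
      assert (D := Hder z ltac:(lra)).
      eexists.
      apply (is_derive_plus (fun z => K * exp (- z / 2)) (fun z => s * osc k c t z)).
      + auto_derive; [trivial|reflexivity].
      + apply (is_derive_scal (osc k c t) z s), D.
    - rewrite Rmin_left, Rmax_right in Hz by lra.
      pose proof (Hdb z ltac:(lra)) as B. apply Rabs_le_between in B.
      destruct Hs; subst s; nra. }
  pose proof (Hmon 1 (or_introl eq_refl)). pose proof (Hmon (-1) (or_intror eq_refl)).
  apply Rabs_le; lra.
Qed.

(** Index [n] stands for the integer [n + 2]: the integer 1 has frequency 0, which cannot be divided
    by, and is kept apart. The sign is opposite to that in eta, so that [osc_series 0 0] is the [D]
    of [Re eta = 1 - D]. *)
Definition osc_term (k : nat) (c t : R) (n : nat) : R :=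
  (-1) ^ n * osc k c t (ln (INR (S (S n)))).

Definition osc_series (k : nat) (c t : R) : R := Series (osc_term k c t).

Lemma half_le_ln (n : nat) : / 2 <= ln (INR (S (S n))).
Proof.
  apply Rle_trans with (ln 2); [left; apply ln_lt_2|].
  rewrite !S_INR. pose proof (pos_INR n). apply ln_le; lra.
Qed.

Lemma ln_INR_le (n m : nat) : (n <= m)%nat -> ln (INR (S (S n))) <= ln (INR (S (S m))).
Proof.
  intros H. apply ln_le; [apply lt_0_INR; lia|apply le_INR; lia].
Qed.

Lemma osc_sum_bound (k : nat) (c t : R) (N M : nat) :
  Rabs (sum_n_m (osc_term k c t) N (N + M))
  <= osc_const k t * exp (- ln (INR (S (S N))) / 2).
Proof.
  apply (alternating_sum_bound (fun n => osc k c t (ln (INR (S (S n)))))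
           (fun n => osc_const k t * exp (- ln (INR (S (S n))) / 2))).
  - intros n. apply osc_bound, half_le_ln.
  - intros n. apply osc_variation. split; [apply half_le_ln|apply ln_INR_le; lia].
Qed.

Lemma osc_sum_cauchy (k : nat) (c t : R) (N n m : nat) :
  (N <= n)%nat -> (N <= m)%nat ->
  Rabs (sum_n (osc_term k c t) n - sum_n (osc_term k c t) m)
  <= osc_const k t * exp (- ln (INR (S (S N))) / 2).
Proof.
  revert n m.
  assert (H : forall n m, (N <= n)%nat -> (n <= m)%nat ->
    Rabs (sum_n (osc_term k c t) m - sum_n (osc_term k c t) n)
    <= osc_const k t * exp (- ln (INR (S (S N))) / 2)).
  { intros n m Hn Hm. pose proof (osc_const_pos k t).
    assert (0 < 2 ^ k) by (apply pow_lt; lra).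
    destruct (Nat.eq_dec n m) as [->|Hne].
    - rewrite Rminus_diag, Rabs_R0.
      pose proof (exp_pos (- ln (INR (S (S N))) / 2)). nra.
    - assert (E : sum_n_m (osc_term k c t) (S n) m
                  = sum_n (osc_term k c t) m - sum_n (osc_term k c t) n)
        by (apply (sum_n_m_sum_n (osc_term k c t)); lia).
      rewrite <- E.
      replace m with (S n + (m - S n))%nat by lia.
      eapply Rle_trans; [apply osc_sum_bound|].
      apply Rmult_le_compat_l; [lra|].
      pose proof (ln_INR_le N (S n) ltac:(lia)).
      destruct (Req_dec (ln (INR (S (S N)))) (ln (INR (S (S (S n)))))) as [->|].
      + lra.
      + left; apply exp_increasing; lra. }
  intros n m Hn Hm. destruct (Nat.le_ge_cases n m).
  - rewrite Rabs_minus_sym. now apply H.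
  - now apply H.
Qed.

Lemma osc_CVU (k : nat) (c B : R) :
  CVU_dom (fun n t => sum_n (osc_term k c t) n) (fun t => - B < t < B).
Proof.
  apply CVU_dom_cauchy. intros eps.
  set (K := 2 ^ k * (1 + 8 * INR k + 2 * B)).
  assert (0 < 2 ^ k) by (apply pow_lt; lra).
  pose proof (pos_INR k).
  destruct (Rle_dec B 0) as [HB|HB].
  { exists 0%nat. intros; lra. }
  assert (HK : 0 < K) by (unfold K; apply Rmult_lt_0_compat; lra).
  assert (He := cond_pos eps).
  assert (HeK : 0 < eps / K) by (apply Rdiv_lt_0_compat; lra).
  (* The threshold is [(K / eps)^2], beyond which [K / sqrt (N + 2) < eps]. *)
  destruct (INR_unbounded (exp (- 2 * ln (eps / K)))) as [N HN].
  exists N. intros n m t Ht Hn Hm.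
  eapply Rle_lt_trans; [apply (osc_sum_cauchy k c t N n m Hn Hm)|].
  assert (Rabs t < B) by (apply Rabs_def1; lra).
  pose proof (exp_pos (- ln (INR (S (S N))) / 2)).
  apply Rle_lt_trans with (K * exp (- ln (INR (S (S N))) / 2)).
  { apply Rmult_le_compat_r; [lra|]. unfold K, osc_const.
    apply Rmult_le_compat_l; lra. }
  clearbody K.
  replace (pos eps) with (K * exp (ln (eps / K)))
    by (rewrite exp_ln by lra; field; lra).
  apply Rmult_lt_compat_l; [lra|]. apply exp_increasing.
  enough (- 2 * ln (eps / K) < ln (INR (S (S N)))) by lra.
  rewrite <- (ln_exp (- 2 * ln (eps / K))).
  apply ln_increasing; [apply exp_pos|].
  rewrite !S_INR. lra.
Qed.

Lemma osc_series_lim (k : nat) (c t : R) :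
  is_lim_seq (sum_n (osc_term k c t)) (osc_series k c t).
Proof.
  apply Lim_seq_correct', ex_lim_seq_cauchy_corr.
  intros eps.
  destruct (proj1 (CVU_dom_cauchy _ _) (osc_CVU k c (Rabs t + 1)) eps) as [N HN].
  exists N. intros n m Hn Hm. apply (HN n m t); auto.
  apply Rabs_lt_between. lra.
Qed.

(** The bound is linear in [|t|] for every [k]: repeated integration does not raise the power of
    [t], which is why averaging often enough wins. *)
Lemma osc_series_bound (k : nat) (c t : R) :
  Rabs (osc_series k c t) <= osc_const k t.
Proof.
  assert (Hn : forall n, - osc_const k t <= sum_n (osc_term k c t) n <= osc_const k t).
  { intros n. apply Rabs_le_between. unfold sum_n.
    eapply Rle_trans; [apply (osc_sum_bound k c t 0 n)|].
    pose proof (osc_const_pos k t). assert (0 < 2 ^ k) by (apply pow_lt; lra).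
    pose proof (half_le_ln 0).
    assert (exp (- ln (INR 2) / 2) < exp 0) by (apply exp_increasing; lra).
    rewrite exp_0 in *. nra. }
  apply Rabs_le. split.
  - apply (is_lim_seq_le (fun _ => - osc_const k t) (sum_n (osc_term k c t))
      (- osc_const k t) (osc_series k c t)); [apply Hn|apply is_lim_seq_const|].
    apply osc_series_lim.
  - apply (is_lim_seq_le (sum_n (osc_term k c t)) (fun _ => osc_const k t)
      (osc_series k c t) (osc_const k t)); [apply Hn| |apply is_lim_seq_const].
    apply osc_series_lim.
Qed.

(** A primitive of [cos (t x - c)] in [t] is [cos (t x - c - PI / 2) / x]: integration adds one to
    [k] and a quarter turn to [c]. *)
Lemma osc_term_derive (k : nat) (c t : R) (n : nat) :
  is_derive (fun t => osc_term (S k) (c + PI / 2) t n) t (osc_term k c t n).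
Proof.
  unfold osc_term, osc. pose proof (half_le_ln n).
  set (x := ln (INR (S (S n)))) in *.
  auto_derive; [trivial|].
  replace (t * x + - (c + PI / 2)) with (- (PI / 2 - (t * x - c))) by ring.
  rewrite sin_neg, sin_shift. unfold Rdiv. simpl. field. lra.
Qed.

Lemma osc_term_ex_derive (k : nat) (c t : R) (n : nat) :
  ex_derive (fun t => osc_term k c t n) t.
Proof. unfold osc_term, osc. auto_derive. trivial. Qed.

Lemma osc_sum_continuous (k : nat) (c t : R) (n : nat) :
  continuity_pt (fun t => sum_n (osc_term k c t) n) t.
Proof.
  apply derivable_continuous_pt, ex_derive_Reals_0.
  exists (sum_n (fun j => Derive (fun t => osc_term k c t j) t) n).
  apply (is_derive_sum_n (fun j t => osc_term k c t j)).
  intros j _. apply Derive_correct, osc_term_ex_derive.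
Qed.

Lemma open_symmetric (B : R) : open (fun t : R => - B < t < B).
Proof. apply open_and; [apply open_gt|apply open_lt]. Qed.

Lemma osc_series_continuous (k : nat) (c t : R) : continuous (osc_series k c) t.
Proof.
  apply continuity_pt_filterlim.
  apply (CVU_cont_open (fun n t => sum_n (osc_term k c t) n)
           (fun x => - (Rabs t + 1) < x < Rabs t + 1)).
  - apply open_symmetric.
  - apply osc_CVU.
  - intros; apply osc_sum_continuous.
  - apply Rabs_lt_between. lra.
Qed.

(** Termwise differentiation, justified by the uniform convergence of both series on a bounded open
    interval around [t]. *)
Lemma osc_series_derive (k : nat) (c t : R) :
  is_derive (osc_series (S k) (c + PI / 2)) t (osc_series k c t).
Proof.
  set (D := fun x => - (Rabs t + 1) < x < Rabs t + 1).
  assert (Hder : forall n x,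
    is_derive (fun t => sum_n (osc_term (S k) (c + PI / 2) t) n) x
      (sum_n (osc_term k c x) n)).
  { intros n x. apply (is_derive_sum_n (fun j t => osc_term (S k) (c + PI / 2) t j)).
    intros j _. apply osc_term_derive. }
  replace (osc_series k c t) with
    (real (Lim_seq (fun n => Derive (fun t => sum_n (osc_term (S k) (c + PI / 2) t) n) t))).
  2:{ unfold osc_series, Series. f_equal. apply Lim_seq_ext. intros n.
      now apply is_derive_unique. }
  apply (CVU_Derive (fun n t => sum_n (osc_term (S k) (c + PI / 2) t) n) D).
  - apply open_symmetric.
  - unfold is_connected, D; intros; lra.
  - apply osc_CVU.
  - intros n x _. eexists. apply Hder.
  - intros n x _. apply continuity_pt_ext with (fun t => sum_n (osc_term k c t) n).
    + intros y. symmetry. now apply is_derive_unique.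
    + apply osc_sum_continuous.
  - intros eps. destruct (osc_CVU k c (Rabs t + 1) eps) as [N HN].
    exists N. intros n Hn x Hx. cbv beta. rewrite (is_derive_unique (fun t : R => sum_n (osc_term (S k) (c + PI / 2) t) n) _ _ (Hder n x)).
    rewrite (Lim_seq_ext _ (fun n => sum_n (osc_term k c x) n)).
    + now apply HN.
    + intros m. now apply is_derive_unique.
  - unfold D. apply Rabs_lt_between. lra.
Qed.

(** * Eta and zeta on the critical line in terms of the oscillating series *)

Lemma exp_half_ln (x : R) : 0 < x -> exp (- ln x / 2) = / sqrt x.
Proof.
  intros Hx. rewrite <- Rpower_sqrt, <- Rpower_Ropp by assumption.
  unfold Rpower. f_equal. field.
Qed.

Lemma eta_series_tail (f : R -> R) (c t : R) (n : nat) :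
  (forall x, f x = cos (x - c)) ->
  (-1) ^ S n / sqrt (INR (S (S n))) * f (t * ln (INR (S (S n))))
  = - osc_term 0 c t n.
Proof.
  intros Hf. unfold osc_term, osc.
  rewrite Hf, exp_half_ln by (apply lt_0_INR; lia).
  simpl pow. unfold Rdiv. ring.
Qed.

Lemma ex_series_osc (k : nat) (c t : R) : ex_series (osc_term k c t).
Proof. exists (osc_series k c t). apply osc_series_lim. Qed.

(** Serves both parts of eta, with [f = cos], [c = 0] and [f = sin], [c = PI / 2]. The term of the
    integer 1 has frequency 0 and gives [f 0]. *)
Lemma eta_series_split (f : R -> R) (c t : R) :
  (forall x, f x = cos (x - c)) ->
  Series (fun n => (-1) ^ n / sqrt (INR (S n)) * f (t * ln (INR (S n))))
  = f 0 - osc_series 0 c t.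
Proof.
  intros Hf. rewrite Series_incr_1.
  - rewrite (Series_ext _ _ (fun n => eta_series_tail f c t n Hf)), Series_opp.
    simpl. rewrite ln_1, sqrt_1, Rmult_0_r. unfold osc_series. field.
  - apply ex_series_incr_1.
    apply (ex_series_ext (fun n => opp (osc_term 0 c t n))).
    + intros n. now rewrite (eta_series_tail f c t n Hf).
    + apply (ex_series_opp (osc_term 0 c t)), ex_series_osc.
Qed.

Lemma eta_re_eq (t : R) : eta_re t = 1 - osc_series 0 0 t.
Proof.
  unfold eta_re. rewrite (eta_series_split cos 0), cos_0; [reflexivity|].
  intros x. f_equal. ring.
Qed.

Lemma eta_im_eq (t : R) : eta_im t = osc_series 0 (PI / 2) t.
Proof.
  unfold eta_im. rewrite (eta_series_split sin (PI / 2)), sin_0; [ring|].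
  intros x. rewrite <- cos_shift, <- (cos_neg (x - PI / 2)). f_equal. ring.
Qed.

Lemma zeta_denominator (t : R) : / 6 <= 3 - 2 * sqrt 2 * cos (t * ln 2) <= 6.
Proof.
  assert (H1 := sqrt_pos 2). assert (H2 : sqrt 2 * sqrt 2 = 2) by (apply sqrt_sqrt; lra).
  (* The fraction is chosen so that [3 - 2 * (17 / 12) = 1 / 6]. *)
  assert (sqrt 2 <= 17 / 12) by nra.
  pose proof (COS_bound (t * ln 2)). split; nra.
Qed.

Lemma zeta_abs2_continuous (t : R) : continuous zeta_abs2 t.
Proof.
  apply continuous_ext with (fun t =>
    ((1 - osc_series 0 0 t) ^ 2 + osc_series 0 (PI / 2) t ^ 2)
    / (3 - 2 * sqrt 2 * cos (t * ln 2))).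
  { intros x. unfold zeta_abs2. now rewrite eta_re_eq, eta_im_eq. }
  pose proof (proj2 (continuity_pt_filterlim _ _) (osc_series_continuous 0 0 t)).
  pose proof (proj2 (continuity_pt_filterlim _ _) (osc_series_continuous 0 (PI / 2) t)).
  apply continuity_pt_filterlim.
  apply continuity_pt_div.
  - apply (continuity_pt_plus (fun t => (1 - osc_series 0 0 t) ^ 2)
             (fun t => osc_series 0 (PI / 2) t ^ 2)).
    + apply (continuity_pt_comp (fun t => 1 - osc_series 0 0 t) (fun x => x ^ 2)); [|reg].
      apply continuity_pt_minus; [reg|assumption].
    + apply (continuity_pt_comp (osc_series 0 (PI / 2)) (fun x => x ^ 2)); [assumption|reg].
  - reg.
  - pose proof (zeta_denominator t). lra.
Qed.

(** Drop [(Im eta)^2] and the square of the series, and bound the denominator by 6. The result is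
    linear in the series, hence can be integrated repeatedly. *)
Lemma zeta_abs2_ge (t : R) : (1 - 2 * osc_series 0 0 t) / 6 <= zeta_abs2 t.
Proof.
  pose proof (zeta_denominator t).
  unfold zeta_abs2. rewrite eta_re_eq.
  set (d := 3 - _) in *. set (y := osc_series 0 0 t).
  pose proof (pow2_ge_0 (eta_im t)). pose proof (pow2_ge_0 y). pose proof (pow2_ge_0 (1 - y)).
  apply Rle_trans with (((1 - y) ^ 2 + eta_im t ^ 2) / 6).
  - apply Rmult_le_compat_r; lra.
  - apply Rmult_le_compat_l; [lra|]. apply Rinv_le_contravar; lra.
Qed.

Lemma zeta_abs2_ge_0 (t : R) : 0 <= zeta_abs2 t.
Proof.
  pose proof (zeta_denominator t). unfold zeta_abs2.
  pose proof (pow2_ge_0 (eta_im t)). pose proof (pow2_ge_0 (eta_re t)).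
  apply Rmult_le_pos; [lra|]. left; apply Rinv_0_lt_compat; lra.
Qed.

(** Crude, but any polynomial bound serves: it is used only to bound the growth of the ladder by a
    power. *)
Lemma zeta_abs2_le (t : R) : zeta_abs2 t <= 48 * (1 + Rabs t) ^ 2.
Proof.
  pose proof (zeta_denominator t).
  pose proof (osc_series_bound 0 0 t) as H1. pose proof (osc_series_bound 0 (PI / 2) t) as H2.
  unfold osc_const in *. simpl in H1, H2.
  pose proof (Rabs_pos t).
  apply Rabs_le_between in H1, H2.
  unfold zeta_abs2. rewrite eta_re_eq, eta_im_eq.
  set (d := 3 - _) in *. set (y := osc_series 0 0 t) in *. set (z := osc_series 0 (PI / 2) t) in *.
  set (r := Rabs t) in *.
  assert (/ d <= 6) by (rewrite <- (Rinv_inv 6); apply Rinv_le_contravar; lra).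
  apply Rle_trans with (((1 - y) ^ 2 + z ^ 2) * 6).
  - apply Rmult_le_compat_l; [|lra].
    pose proof (pow2_ge_0 (1 - y)). pose proof (pow2_ge_0 z). lra.
  - assert ((1 - y) ^ 2 <= (2 + 2 * r) ^ 2) by (apply pow_maj_Rabs, Rabs_le; lra).
    assert (z ^ 2 <= (1 + 2 * r) ^ 2) by (apply pow_maj_Rabs, Rabs_le; lra).
    nra.
Qed.

(** * The second moment of zeta on short intervals *)

Lemma ex_RInt_cont (f : R -> R) (a b : R) : (forall x, continuous f x) -> ex_RInt f a b.
Proof. intros Hf. apply (ex_RInt_continuous (V := R_CompleteNormedModule)). auto. Qed.

Lemma is_derive_RInt_cont (f : R -> R) (a x : R) :
  (forall x, continuous f x) -> is_derive (fun y => RInt f a y) x (f x).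
Proof.
  intros Hf. apply (is_derive_RInt f _ a); [|apply Hf].
  apply filter_forall. intros y. apply (RInt_correct f), ex_RInt_cont, Hf.
Qed.

Lemma RInt_sub_primitive (f F : R -> R) (a b : R) :
  (forall x, Rmin a b <= x <= Rmax a b -> is_derive F x (f x)) ->
  (forall x, Rmin a b <= x <= Rmax a b -> continuous f x) ->
  RInt f a b = F b - F a.
Proof. intros HF Hf. apply is_RInt_unique, (is_RInt_derive F f a b HF Hf). Qed.

Lemma RInt_Chasles_cont (f : R -> R) (a b c : R) :
  (forall x, continuous f x) -> RInt f a b + RInt f b c = RInt f a c.
Proof. intros Hf. apply (RInt_Chasles f); apply ex_RInt_cont, Hf. Qed.

Lemma RInt_subset (f : R -> R) (a b c d : R) :
  (forall x, continuous f x) -> (forall x, 0 <= f x) ->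
  a <= b -> b <= c -> c <= d -> RInt f b c <= RInt f a d.
Proof.
  intros Hc Hf ab bc cd.
  rewrite <- (RInt_Chasles_cont f a b d Hc), <- (RInt_Chasles_cont f b c d Hc).
  pose proof (RInt_ge_0 f a b ab (ex_RInt_cont f a b Hc) (fun x _ => Hf x)).
  pose proof (RInt_ge_0 f c d cd (ex_RInt_cont f c d Hc) (fun x _ => Hf x)).
  lra.
Qed.

(** An unnormalised [k]-fold moving average: a constant [m] becomes [m h^k], and the value at [x]
    depends on [f] over [[x, x + k h]] only. *)
Fixpoint window_iter (k : nat) (h : R) (f : R -> R) (x : R) : R :=
  match k with
  | O => f x
  | S j => window_iter j h (fun y => RInt f y (y + h)) x
  end.

Lemma window_continuous (h : R) (f : R -> R) :
  (forall x, continuous f x) -> forall x, continuous (fun y => RInt f y (y + h)) x.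
Proof.
  intros Hf x.
  apply continuous_ext with (fun y => RInt f 0 (y + h) - RInt f 0 y).
  - intros y. rewrite <- (RInt_Chasles_cont f 0 y (y + h) Hf). apply Rplus_minus_l.
  - apply (ex_derive_continuous (fun y => RInt f 0 (y + h) - RInt f 0 y)).
    exists (f (x + h) - f x).
    apply (is_derive_minus (fun y => RInt f 0 (y + h)) (fun y => RInt f 0 y)).
    + replace (f (x + h)) with (scal 1 (f (x + h))) by apply Rmult_1_l.
      apply (is_derive_comp (fun z => RInt f 0 z) (fun y => y + h)).
      * apply is_derive_RInt_cont, Hf.
      * auto_derive; trivial.
    + apply is_derive_RInt_cont, Hf.
Qed.

Lemma window_iter_le (k : nat) (h x : R) (f g : R -> R) :
  0 <= h ->
  (forall x, continuous f x) -> (forall x, continuous g x) ->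
  (forall y, x <= y <= x + INR k * h -> f y <= g y) ->
  window_iter k h f x <= window_iter k h g x.
Proof.
  intros Hh. revert f g; induction k as [|k IH]; intros f g Hf Hg Hle.
  - simpl. apply Hle. simpl. lra.
  - simpl. apply IH; [now apply window_continuous..|].
    intros y Hy. apply RInt_le; [lra|now apply ex_RInt_cont..|].
    intros z Hz. apply Hle. rewrite S_INR. lra.
Qed.

Lemma window_iter_ext (k : nat) (h x : R) (f g : R -> R) :
  (forall y, f y = g y) -> window_iter k h f x = window_iter k h g x.
Proof.
  revert f g; induction k as [|k IH]; intros f g E; simpl; [apply E|].
  apply IH. intros y. apply RInt_ext. intros; apply E.
Qed.

Lemma window_iter_const (k : nat) (h m x : R) :
  window_iter k h (fun _ => m) x = m * h ^ k.
Proof.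
  revert m; induction k as [|k IH]; intros m; simpl; [ring|].
  transitivity (window_iter k h (fun _ => m * h) x); [|rewrite IH; ring].
  apply window_iter_ext. intros y. rewrite RInt_const. unfold scal; simpl. unfold mult; simpl. ring.
Qed.

(** Each window turns a function into a difference of two values of its primitive. After [k] windows
    there are [2^k] signed values of [F k], whatever the size of [h]. *)
Lemma window_iter_primitive (k : nat) (h x b : R) (F : nat -> R -> R) :
  0 <= h ->
  (forall j y, is_derive (F (S j)) y (F j y)) -> (forall y, continuous (F O) y) ->
  (forall y, x <= y <= x + INR k * h -> Rabs (F k y) <= b) ->
  Rabs (window_iter k h (F O) x) <= 2 ^ k * b.
Proof.
  intros Hh. revert F b; induction k as [|k IH]; intros F b HF H0 Hb.
  - simpl. rewrite Rmult_1_l. apply Hb. simpl. lra.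
  - simpl.
    set (G := fun j y => F (S j) (y + h) - F (S j) y).
    assert (EG : forall y, RInt (F O) y (y + h) = G O y).
    { intros y. apply (RInt_sub_primitive (F O) (F 1%nat)); auto. }
    assert (HG : forall j y, is_derive (G (S j)) y (G j y)).
    { intros j y. apply (is_derive_minus (fun y => F (S (S j)) (y + h)) (F (S (S j)))).
      - replace (F (S j) (y + h)) with (scal 1 (F (S j) (y + h))) by apply Rmult_1_l.
        apply (is_derive_comp (F (S (S j))) (fun y => y + h)); [apply HF|].
        auto_derive; trivial.
      - apply HF. }
    rewrite (window_iter_ext k h x _ _ EG).
    replace (2 * 2 ^ k * b) with (2 ^ k * (2 * b)) by ring.
    apply IH; [exact HG| |].
    + intros y. apply continuous_ext with (fun y => RInt (F O) y (y + h)); [exact EG|].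
      now apply window_continuous.
    + intros y Hy. unfold G.
      rewrite S_INR in Hb.
      pose proof (Hb y ltac:(lra)). pose proof (Hb (y + h) ltac:(lra)).
      unfold Rminus. eapply Rle_trans; [apply Rabs_triang|]. rewrite Rabs_Ropp. lra.
Qed.

(** Average [zeta_abs2 - 1/6] over [k + 1] windows. The first window gives at most [M - h / 6], with
    [M] the whole integral, and the others multiply by [h^k]. From below, the function is at least
    [- 1/3] times [osc_series 0 0], whose averages are bounded through its [(k + 1)]-fold
    primitive. *)
Lemma zeta_short_integral (k : nat) (x h : R) :
  0 <= x -> 0 < h ->
  (h / 6 - RInt zeta_abs2 x (x + INR (S k) * h)) * h ^ k
  <= 2 ^ S k * osc_const (S k) (x + INR (S k) * h) / 3.
Proof.
  intros Hx Hh.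
  set (M := RInt zeta_abs2 x (x + INR (S k) * h)).
  set (f := fun t => zeta_abs2 t - / 6).
  set (F := fun j t => - / 3 * osc_series j (INR j * (PI / 2)) t).
  assert (Hfc : forall t, continuous f t).
  { intros t. apply (continuous_minus zeta_abs2 (fun _ => / 6));
      [apply zeta_abs2_continuous|apply continuous_const]. }
  assert (HFc : forall t, continuous (F O) t).
  { intros t. apply (continuous_scal_r (- / 3) (osc_series 0 (INR 0 * (PI / 2)))).
    apply osc_series_continuous. }
  assert (H1 : window_iter (S k) h f x <= (M - h / 6) * h ^ k).
  { rewrite <- (window_iter_const k h (M - h / 6) x). simpl.
    apply window_iter_le; [lra|now apply window_continuous|intros; apply continuous_const|].
    intros y Hy. unfold f.
    rewrite (RInt_minus zeta_abs2 (fun _ => / 6))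
      by (apply ex_RInt_cont; intros; first [apply zeta_abs2_continuous|apply continuous_const]).
    rewrite RInt_const.
    assert (RInt zeta_abs2 y (y + h) <= M).
    { apply RInt_subset; [apply zeta_abs2_continuous|apply zeta_abs2_ge_0|lra|lra|].
      rewrite S_INR. lra. }
    unfold minus, plus, opp, scal; simpl. unfold mult; simpl. lra. }
  assert (H2 : window_iter (S k) h (F O) x <= window_iter (S k) h f x).
  { apply window_iter_le; [lra|assumption|assumption|].
    intros y _. unfold F, f. simpl INR. rewrite Rmult_0_l.
    pose proof (zeta_abs2_ge y). lra. }
  assert (H3 : Rabs (window_iter (S k) h (F O) x)
               <= 2 ^ S k * (osc_const (S k) (x + INR (S k) * h) / 3)).
  { apply window_iter_primitive; [lra| |assumption|].
    - intros j y. apply (is_derive_scal (osc_series (S j) (INR (S j) * (PI / 2))) y (- / 3)).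
      rewrite S_INR, Rmult_plus_distr_r, Rmult_1_l. apply osc_series_derive.
    - intros y Hy. unfold F. rewrite Rabs_mult, Rabs_Ropp, (Rabs_pos_eq (/ 3)) by lra.
      pose proof (osc_series_bound (S k) (INR (S k) * (PI / 2)) y).
      assert (osc_const (S k) y <= osc_const (S k) (x + INR (S k) * h)).
      { unfold osc_const. assert (0 < 2 ^ S k) by (apply pow_lt; lra).
        apply Rmult_le_compat_l; [lra|].
        rewrite !Rabs_pos_eq by lra. lra. }
      lra. }
  apply Rabs_le_between in H3.
  lra.
Qed.

Lemma exp_monotone (x y : R) : x <= y -> exp x <= exp y.
Proof. intros [H| ->]; [left; now apply exp_increasing|lra]. Qed.

(** Split the interval of length [w = x^eps] into [N] windows of length [h = w / N]. For large [N]
    the main term [h^N] exceeds the error, which is linear in [x], and half of [h / 6] survives. *)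
Lemma zeta_power_interval (eps : R) :
  0 < eps <= 1 ->
  exists c X, 0 < c /\ 1 <= X /\ forall x, X <= x ->
    c * exp (eps * ln x) <= RInt zeta_abs2 x (x + exp (eps * ln x)).
Proof.
  intros He. destruct (INR_unbounded (2 / eps)) as [n Hn].
  destruct n as [|k].
  { exfalso. simpl in Hn. assert (0 < 2 / eps) by (apply Rdiv_lt_0_compat; lra). lra. }
  set (N := INR (S k)) in *.
  assert (HN : 2 < eps * N).
  { apply Rmult_lt_reg_l with (/ eps); [apply Rinv_0_lt_compat; lra|].
    rewrite <- Rmult_assoc, Rinv_l by lra. lra. }
  assert (HN0 : 0 < N) by (apply lt_0_INR; lia).
  assert (H4 : 0 < 4 ^ S k) by (apply pow_lt; lra).
  assert (HNk : 0 < N ^ S k) by (now apply pow_lt).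
  (* The error term of [zeta_short_integral], multiplied by [12 N^N], is at most [K x]; here
     [8 N + 5] comes from [1 + 8 N + 2 (x + w) <= (8 N + 5) x]. *)
  set (K := 4 * 4 ^ S k * (8 * N + 5) * N ^ S k).
  assert (HK : 0 < K) by (apply Rmult_lt_0_compat; [apply Rmult_lt_0_compat|]; lra).
  exists (/ (12 * N)), (Rmax 1 K). split; [|split].
  { apply Rinv_0_lt_compat; lra. }
  { apply Rmax_l. }
  intros x Hx. pose proof (Rmax_l 1 K). pose proof (Rmax_r 1 K).
  set (s := ln x). assert (Hs : 0 <= s) by (unfold s; rewrite <- ln_1; apply ln_le; lra).
  assert (Exs : exp s = x) by (apply exp_ln; lra).
  set (w := exp (eps * s)).
  assert (HHx : w <= x) by (rewrite <- Exs; apply exp_monotone; nra).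
  assert (HH : 0 < w) by apply exp_pos.
  set (h := w / N).
  assert (Hh : 0 < h) by (apply Rdiv_lt_0_compat; lra).
  assert (ENh : N * h = w) by (unfold h; field; lra).
  pose proof (zeta_short_integral k x h ltac:(lra) Hh) as Z.
  fold N in Z. rewrite ENh in Z.
  assert (HO : osc_const (S k) (x + w) <= 2 ^ S k * ((8 * N + 5) * x)).
  { unfold osc_const. apply Rmult_le_compat_l; [apply pow_le; lra|].
    fold N. rewrite Rabs_pos_eq by lra.
    pose proof (Rmult_le_pos N (x - 1) ltac:(lra) ltac:(lra)). lra. }
  assert (HHn : x * x <= w ^ S k).
  { rewrite <- Rpower_pow by assumption. unfold Rpower, w. rewrite ln_exp. fold N.
    rewrite <- Exs, <- exp_plus. apply exp_monotone. nra. }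
  assert (HhN : h ^ S k * N ^ S k = w ^ S k).
  { rewrite <- Rpow_mult_distr. f_equal. rewrite Rmult_comm. exact ENh. }
  assert (Hmain : (h / 6 - RInt zeta_abs2 x (x + w)) * h ^ k <= h / 12 * h ^ k).
  { eapply Rle_trans; [exact Z|].
    replace (h / 12 * h ^ k) with (h ^ S k / 12) by (simpl; field).
    apply Rmult_le_reg_r with (12 * N ^ S k); [lra|].
    replace (h ^ S k / 12 * (12 * N ^ S k)) with (w ^ S k) by (rewrite <- HhN; field).
    apply Rle_trans with (x * x); [|exact HHn].
    apply Rle_trans with (K * x); [|nra].
    apply Rle_trans with (2 ^ S k * (2 ^ S k * ((8 * N + 5) * x)) / 3 * (12 * N ^ S k)).
    - apply Rmult_le_compat_r; [lra|]. apply Rmult_le_compat_r; [lra|].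
      apply Rmult_le_compat_l; [apply pow_le; lra|exact HO].
    - unfold K. replace (4 ^ S k) with (2 ^ S k * 2 ^ S k)
        by (rewrite <- Rpow_mult_distr; f_equal; ring).
      right. field. }
  apply Rmult_le_reg_r in Hmain; [|now apply pow_lt].
  replace (/ (12 * N) * w) with (h / 12) by (unfold h; field; lra).
  lra.
Qed.

(** * Reverse iterations of Jacob's ladder *)

Lemma exp_dominates_affine (eps K : R) :
  0 < eps -> exists S, 0 <= S /\ forall s, S <= s -> K * (1 + s) <= exp (eps * s).
Proof.
  (* For such [s], [K (1 + s) <= 2 |K| s <= (eps s)^2 / 4 <= exp (eps s)]. *)
  intros He. exists (1 + 8 * Rabs K / eps ^ 2).
  assert (He2 : 0 < eps ^ 2) by (now apply pow_lt).
  pose proof (Rabs_pos K) as HK. pose proof (Rle_abs K) as HK'.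
  assert (0 <= 8 * Rabs K / eps ^ 2)
    by (apply Rmult_le_pos; [lra|left; now apply Rinv_0_lt_compat]).
  split; [lra|]. intros s Hs.
  assert (H8 : 8 * Rabs K <= eps ^ 2 * s).
  { replace (8 * Rabs K) with (eps ^ 2 * (8 * Rabs K / eps ^ 2)) by (field; lra).
    apply Rmult_le_compat_l; lra. }
  assert (Hexp : 1 + eps * s / 2 <= exp (eps * s / 2)) by apply exp_ineq1_le.
  replace (eps * s) with (eps * s / 2 + eps * s / 2) by field.
  rewrite exp_plus.
  assert (0 <= eps * s) by (apply Rmult_le_pos; lra).
  apply Rle_trans with ((1 + eps * s / 2) * (1 + eps * s / 2)); [|nra].
  apply Rle_trans with (2 * Rabs K * s); [nra|].
  apply Rle_trans with (eps ^ 2 * s * s / 4); [|nra].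
  pose proof (Rmult_le_compat_r s _ _ ltac:(lra) H8). lra.
Qed.

Lemma omega_equiv_ln (omega : R -> R) :
  (exists C t1, forall t, t1 <= t ->
       Rabs (omega t / ln t - 1) <= C * (ln (ln t) / ln t)) ->
  forall eta, 0 < eta -> exists A, exp 1 <= A /\
    forall t, A <= t -> Rabs (omega t - ln t) <= eta * ln t.
Proof.
  intros [C [t1 HC]] eta Heta.
  (* To be used at [s = ln (ln t)], where it reads [|C| (1 + ln (ln t)) <= eta ln t]; this explains
     the threshold [exp (exp S)]. *)
  destruct (exp_dominates_affine 1 (Rabs C / eta) ltac:(lra)) as [S [HS0 HS]].
  exists (Rmax (Rmax (exp 1) t1) (exp (exp S))).
  split; [eapply Rle_trans; [|apply Rmax_l]; apply Rmax_l|].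
  intros t Ht.
  assert (exp 1 <= t) by (eapply Rle_trans; [|exact Ht]; eapply Rle_trans; [|apply Rmax_l]; apply Rmax_l).
  assert (Ht1 : t1 <= t) by (eapply Rle_trans; [|exact Ht]; eapply Rle_trans; [|apply Rmax_l]; apply Rmax_r).
  assert (exp (exp S) <= t) by (eapply Rle_trans; [|exact Ht]; apply Rmax_r).
  specialize (HC t Ht1).
  assert (H1 : 1 <= ln t) by (rewrite <- (ln_exp 1); apply ln_le; [apply exp_pos|assumption]).
  assert (H2 : S <= ln (ln t)).
  { rewrite <- (ln_exp S). apply ln_le; [apply exp_pos|].
    rewrite <- (ln_exp (exp S)). apply ln_le; [apply exp_pos|assumption]. }
  specialize (HS _ H2). rewrite Rmult_1_l, exp_ln in HS by lra.
  assert (HS' : Rabs C * (1 + ln (ln t)) <= eta * ln t).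
  { replace (Rabs C * (1 + ln (ln t))) with (eta * (Rabs C / eta * (1 + ln (ln t))))
      by (field; lra).
    apply Rmult_le_compat_l; lra. }
  replace (omega t - ln t) with ((omega t / ln t - 1) * ln t) by (field; lra).
  rewrite Rabs_mult, (Rabs_pos_eq (ln t)) by lra.
  apply Rle_trans with (C * (ln (ln t) / ln t) * ln t).
  { apply Rmult_le_compat_r; lra. }
  replace (C * (ln (ln t) / ln t) * ln t) with (C * ln (ln t)) by (field; lra).
  pose proof (Rle_abs C). pose proof (Rabs_pos C). nra.
Qed.

(** On [[a, 2 a]] the logarithm varies by at most [ln 2], which is negligible against [ln a]. *)
Lemma omega_ratio (omega : R -> R) :
  (forall eta, 0 < eta -> exists A, exp 1 <= A /\
    forall t, A <= t -> Rabs (omega t - ln t) <= eta * ln t) ->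
  forall eta, 0 < eta -> exists A, forall a x y, A <= a ->
    a <= x <= 2 * a -> a <= y <= 2 * a ->
    Rabs (omega x / omega y - 1) <= eta.
Proof.
  intros Hom eta Heta.
  (* With [l = ln a] and [d l >= 1], [omega] stays between [(1 - d) l] and [(1 + d)^2 l] on
     [[a, 2 a]]. The spread is at most [4 d l <= eta l / 2], and [omega y >= l / 2]. *)
  set (d := Rmin (/ 2) (eta / 8)).
  assert (Hd : 0 < d) by (apply Rmin_glb_lt; lra).
  assert (Hd1 : d <= / 2) by apply Rmin_l.
  assert (Hd2 : d <= eta / 8) by apply Rmin_r.
  clearbody d.
  destruct (Hom d Hd) as [A [HA1 HA]].
  exists (Rmax A (exp (/ d))). intros a x y Ha Hx Hy.
  assert (A <= a) by (eapply Rle_trans; [apply Rmax_l|exact Ha]).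
  assert (exp (/ d) <= a) by (eapply Rle_trans; [apply Rmax_r|exact Ha]).
  pose proof (exp_pos 1).
  set (l := ln a).
  assert (Hl : / d <= l) by (rewrite <- (ln_exp (/ d)); apply ln_le; [apply exp_pos|assumption]).
  assert (Hl1 : 1 <= d * l).
  { rewrite <- (Rinv_r d) by lra. apply Rmult_le_compat_l; lra. }
  assert (Hln : forall z, a <= z <= 2 * a -> l <= ln z <= l + 1).
  { intros z Hz. split; [apply ln_le; lra|].
    apply Rle_trans with (ln (2 * a)); [apply ln_le; lra|].
    rewrite ln_mult by lra. pose proof (ln_le 2 (exp 1) ltac:(lra)) as E.
    rewrite ln_exp in E. pose proof (exp_ineq1_le 1). fold l. lra. }
  assert (Hl0 : 0 < l) by nra.
  assert (Hw : forall z, a <= z <= 2 * a -> (1 - d) * l <= omega z <= (1 + d) * ((1 + d) * l)).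
  { intros z Hz. pose proof (HA z ltac:(lra)) as B. pose proof (Hln z Hz).
    apply Rabs_le_between in B. split; nra. }
  pose proof (Hw x Hx) as Wx. pose proof (Hw y Hy) as Wy.
  assert (Hy0 : l / 2 <= omega y) by nra.
  replace (omega x / omega y - 1) with ((omega x - omega y) / omega y) by (field; lra).
  rewrite Rabs_div, (Rabs_pos_eq (omega y)) by lra.
  apply Rmult_le_reg_r with (omega y); [lra|].
  unfold Rdiv. rewrite Rmult_assoc, Rinv_l, Rmult_1_r by lra.
  apply Rle_trans with (4 * d * l); [|nra].
  apply Rabs_le. split; nra.
Qed.

(* The integral equation bounds [phi T] in terms of [T], because the second
   moment of zeta diverges; hence arguments with large values are large. *)
Lemma ladder_arg_large (mu_fun phi : R -> R) (T0 : R) :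
  (forall y, 0 < y -> 7 * y * ln y < mu_fun y) ->
  (forall T, T0 < T -> jacob_eq mu_fun phi T) ->
  forall B, exists Y, forall T, T0 < T -> Y <= phi T / 2 -> B < T.
Proof.
  intros Hmu Hphi B0. set (B := Rmax B0 0).
  assert (HB0 : B0 <= B) by apply Rmax_l. assert (HB : 0 <= B) by apply Rmax_r.
  destruct (zeta_power_interval 1 ltac:(lra)) as [c [X [Hc [HX1 HX]]]].
  set (I := RInt zeta_abs2 0 B).
  assert (HI : 0 <= I) by (apply RInt_ge_0; [lra|apply ex_RInt_cont, zeta_abs2_continuous|intros; apply zeta_abs2_ge_0]).
  (* If [T <= B], the right side of the ladder equation is at most [I]. On [[x, 2 x]] the weight is
     at least [exp (- 2)], because [phi T >= 2 x], so the left side is at least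
     [exp (- 2) c x >= I + 1]. *)
  set (x := Rmax (Rmax X (exp 1)) (exp 2 * (I + 1) / c)).
  assert (Hx1 : X <= x) by (eapply Rle_trans; [|apply Rmax_l]; apply Rmax_l).
  assert (Hx2 : exp 1 <= x) by (eapply Rle_trans; [|apply Rmax_l]; apply Rmax_r).
  assert (Hx3 : exp 2 * (I + 1) <= c * x).
  { replace (exp 2 * (I + 1)) with (c * (exp 2 * (I + 1) / c)) by (field; lra).
    apply Rmult_le_compat_l; [lra|apply Rmax_r]. }
  clearbody x. exists x. intros T HT HY.
  apply Rnot_le_lt. intros HTB.
  specialize (Hphi T HT). unfold jacob_eq in Hphi.
  set (y := phi T) in *. clearbody y.
  specialize (HX x Hx1). rewrite Rmult_1_l, exp_ln in HX by lra.
  assert (H1 : RInt zeta_abs2 0 T <= I).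
  { unfold I. rewrite <- (RInt_Chasles_cont zeta_abs2 0 T B zeta_abs2_continuous).
    enough (0 <= RInt zeta_abs2 T B) by lra.
    apply RInt_ge_0; [lra|apply ex_RInt_cont, zeta_abs2_continuous|intros; apply zeta_abs2_ge_0]. }
  set (f := fun t => zeta_abs2 t * exp (- (2 / y) * t)) in *.
  assert (Hf : forall t, continuous f t).
  { intros t. apply (continuous_mult zeta_abs2 (fun t => exp (- (2 / y) * t)));
      [apply zeta_abs2_continuous|].
    apply (ex_derive_continuous (fun t => exp (- (2 / y) * t))). auto_derive. trivial. }
  assert (Hf0 : forall t, 0 <= f t).
  { intros t. apply Rmult_le_pos; [apply zeta_abs2_ge_0|left; apply exp_pos]. }
  assert (Hmy : y <= mu_fun y).
  { assert (1 <= ln y) by (rewrite <- (ln_exp 1); apply ln_le; [apply exp_pos|lra]).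
    pose proof (Hmu y ltac:(lra)). nra. }
  assert (H2 : RInt f x (x + x) <= RInt f 0 (mu_fun y))
    by (apply RInt_subset; auto; lra).
  assert (H3 : RInt (fun t => exp (- 2) * zeta_abs2 t) x (x + x) <= RInt f x (x + x)).
  { apply RInt_le; [lra| |now apply ex_RInt_cont|].
    - apply ex_RInt_cont. intros t. apply (continuous_scal_r (exp (- 2)) zeta_abs2).
      apply zeta_abs2_continuous.
    - intros t Ht. unfold f. rewrite Rmult_comm.
      apply Rmult_le_compat_l; [apply zeta_abs2_ge_0|].
      apply exp_monotone. apply Rmult_le_reg_r with y; [lra|].
      replace (- (2 / y) * t * y) with (- 2 * t) by (field; lra). lra. }
  rewrite (RInt_scal zeta_abs2) in H3 by (apply ex_RInt_cont, zeta_abs2_continuous).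
  change (scal (exp (- 2)) (RInt zeta_abs2 x (x + x)))
    with (exp (- 2) * RInt zeta_abs2 x (x + x)) in H3.
  assert (H4 : I + 1 <= exp (- 2) * RInt zeta_abs2 x (x + x)).
  { replace (I + 1) with (exp (- 2) * (exp 2 * (I + 1))).
    - apply Rmult_le_compat_l; [left; apply exp_pos|lra].
    - rewrite <- Rmult_assoc, <- exp_plus. replace (- 2 + 2) with 0 by ring. rewrite exp_0. ring. }
  lra.
Qed.

(** * Growth of Jacob's ladder *)

Definition ladder_regular (omega f : R -> R) (A : R) : Prop :=
  forall t, A <= t ->
    is_derive f t (Zt2 omega t) /\ 1 <= ln t /\ 1 <= t /\ ln t / 2 <= omega t <= 2 * ln t.

Lemma Zt2_bounds (omega f : R -> R) (A t : R) :
  ladder_regular omega f A -> A <= t ->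
  zeta_abs2 t / (2 * ln t) <= Zt2 omega t <= 2 * zeta_abs2 t.
Proof.
  intros H Ht. destruct (H t Ht) as [_ [H1 [_ [H2 H3]]]].
  pose proof (zeta_abs2_ge_0 t). unfold Zt2.
  split; [apply Rmult_le_compat_l; [lra|apply Rinv_le_contravar; lra]|].
  rewrite (Rmult_comm 2). apply Rmult_le_compat_l; [lra|].
  rewrite <- (Rinv_inv 2). apply Rinv_le_contravar; lra.
Qed.

Lemma mean_value (f df : R -> R) (a b : R) :
  a <= b -> (forall t, a <= t <= b -> is_derive f t (df t)) ->
  exists x, a <= x <= b /\ f b - f a = df x * (b - a).
Proof.
  intros Hab Hd.
  destruct (MVT_gen f a b df) as [x [Hx E]]; rewrite ?Rmin_left, ?Rmax_right in * by lra.
  - intros t Ht. apply Hd. lra.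
  - intros t Ht. apply derivable_continuous_pt, ex_derive_Reals_0.
    exists (df t). now apply Hd.
  - now exists x.
Qed.

Lemma ladder_increment (omega f : R -> R) (A a w : R) :
  ladder_regular omega f A -> A <= a -> 0 <= w <= a ->
  RInt zeta_abs2 a (a + w) / (2 * ln (2 * a)) <= f (a + w) - f a.
Proof.
  intros H Ha Hw. destruct (H a Ha) as [_ [Hl [Ha1 _]]].
  set (l := 2 * ln (2 * a)).
  assert (Hl0 : forall t, a <= t <= a + w -> 0 < 2 * ln t <= l).
  { intros t Ht. assert (ln a <= ln t) by (apply ln_le; lra).
    assert (ln t <= ln (2 * a)) by (apply ln_le; lra). unfold l. lra. }
  assert (Hl1 : 0 < l) by (pose proof (Hl0 a ltac:(lra)); lra).
  (* Comparing derivatives avoids integrating [Zt2 omega], as [omega] is not known to be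
     continuous. *)
  destruct (mean_value (fun t => f t - / l * RInt zeta_abs2 a t)
    (fun t => Zt2 omega t - / l * zeta_abs2 t) a (a + w)) as [x [Hx E]]; [lra| |].
  - intros t Ht. apply (is_derive_minus f (fun t => / l * RInt zeta_abs2 a t)).
    + apply H. lra.
    + apply (is_derive_scal (fun t => RInt zeta_abs2 a t)).
      apply is_derive_RInt_cont, zeta_abs2_continuous.
  - rewrite RInt_point in E. change (@zero R_CompleteNormedModule) with 0 in E.
    assert (0 <= Zt2 omega x - / l * zeta_abs2 x).
    { pose proof (Zt2_bounds omega f A x H ltac:(lra)) as [B _].
      assert (/ l * zeta_abs2 x <= zeta_abs2 x / (2 * ln x)); [|lra].
      rewrite Rmult_comm. apply Rmult_le_compat_l; [apply zeta_abs2_ge_0|].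
      pose proof (Hl0 x Hx). apply Rinv_le_contravar; lra. }
    unfold Rdiv. nra.
Qed.

Lemma ladder_monotone (omega f : R -> R) (A a b : R) :
  ladder_regular omega f A -> A <= a -> a <= b -> f a <= f b.
Proof.
  intros H Ha Hab.
  destruct (mean_value f (Zt2 omega) a b) as [x [Hx E]]; [lra| |].
  - intros t Ht. apply H. lra.
  - pose proof (Zt2_bounds omega f A x H ltac:(lra)) as [B _].
    assert (0 <= zeta_abs2 x / (2 * ln x)).
    { apply Rmult_le_pos; [apply zeta_abs2_ge_0|].
      destruct (H x) as [_ [Hl _]]; [lra|]. left; apply Rinv_0_lt_compat; lra. }
    nra.
Qed.

(** Gives [ln (f a) <= 4 ln a], so that a small power of [f a] is a small power of [a]. *)
Lemma ladder_polynomial_bound (omega f : R -> R) (A : R) :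
  ladder_regular omega f A -> exists A', A <= A' /\ forall a, A' <= a -> f a <= a ^ 4.
Proof.
  intros H.
  (* The derivative is at most [2 * 48 (2 a)^2 = 384 a^2] on [[A, a]], whence
     [f a <= f A + 384 a^3 <= K a^3 <= a^4] for [a >= K]. *)
  set (K := Rabs (f A) + 400).
  assert (HK : 400 <= K) by (unfold K; pose proof (Rabs_pos (f A)); lra).
  exists (Rmax A K). split; [apply Rmax_l|]. intros a Ha.
  assert (HaA : A <= a) by (eapply Rle_trans; [apply Rmax_l|exact Ha]).
  assert (HaK : K <= a) by (eapply Rle_trans; [apply Rmax_r|exact Ha]).
  destruct (H A ltac:(lra)) as [_ [_ [HA1 _]]].
  destruct (mean_value f (Zt2 omega) A a HaA) as [x [Hx E]].
  - intros t Ht. apply H. lra.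
  - pose proof (Zt2_bounds omega f A x H ltac:(lra)) as [_ B].
    pose proof (zeta_abs2_le x) as C. rewrite Rabs_pos_eq in C by lra.
    assert ((1 + x) ^ 2 <= (2 * a) ^ 2) by (apply pow_incr; lra).
    assert (D : Zt2 omega x * (a - A) <= 384 * a ^ 2 * a).
    { apply Rle_trans with (384 * a ^ 2 * (a - A)).
      - apply Rmult_le_compat_r; lra.
      - pose proof (pow2_ge_0 a). apply Rmult_le_compat_l; lra. }
    pose proof (Rle_abs (f A)).
    assert (Ha3 : 1 <= a ^ 3) by (apply pow_R1_Rle; lra).
    replace (a ^ 4) with (a * a ^ 3) by ring.
    replace (384 * a ^ 2 * a) with (384 * a ^ 3) in D by ring.
    unfold K in *. pose proof (Rabs_pos (f A)). nra.
Qed.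

(** If [b] lay beyond [a + a^eps], the ladder would grow by at least [c a^eps / (2 ln (2 a))]. The
    assumed gap is at most [(a^4)^(eps / 8) = a^(eps / 2)], which is smaller for large [a]. *)
Lemma ladder_pullback_gap (omega f : R -> R) (A eps : R) :
  ladder_regular omega f A -> 0 < eps <= 1 ->
  exists A', forall a b, A' <= a -> 0 < f a ->
    f b - f a <= exp (eps / 8 * ln (f a)) -> b - a <= exp (eps * ln a).
Proof.
  intros H He.
  destruct (zeta_power_interval eps He) as [c [X [Hc [HX1 HX]]]].
  destruct (ladder_polynomial_bound omega f A H) as [A1 [HA1 Hpoly]].
  (* Yields [4 (1 + ln a) <= c a^(eps / 2)], against the bound [2 (1 + ln a)] that a large gap would
     force. *)
  destruct (exp_dominates_affine (eps / 2) (4 / c) ltac:(lra)) as [S [HS0 HS]].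
  exists (Rmax (Rmax X A1) (exp S)). intros a b Ha Hfa Hgap.
  assert (HaX : X <= a) by (eapply Rle_trans; [|exact Ha]; eapply Rle_trans; [|apply Rmax_l]; apply Rmax_l).
  assert (HaA : A1 <= a) by (eapply Rle_trans; [|exact Ha]; eapply Rle_trans; [|apply Rmax_l]; apply Rmax_r).
  assert (HaS : exp S <= a) by (eapply Rle_trans; [|exact Ha]; apply Rmax_r).
  specialize (HX a HaX). specialize (Hpoly a HaA).
  destruct (H a ltac:(lra)) as [_ [Hl [Ha1 _]]].
  set (s := ln a) in *.
  assert (Hs : S <= s) by (rewrite <- (ln_exp S); apply ln_le; [apply exp_pos|assumption]).
  specialize (HS s Hs).
  set (w := exp (eps * s)) in *.
  assert (Hw0 : 0 < w) by apply exp_pos.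
  assert (Hwa : w <= a).
  { rewrite <- (exp_ln a) by lra. apply exp_monotone. fold s. nra. }
  apply Rnot_lt_le. intros Hb.
  pose proof (ladder_increment omega f A a w H ltac:(lra) ltac:(lra)) as Hinc.
  pose proof (ladder_monotone omega f A (a + w) b H ltac:(lra) ltac:(lra)) as Hmon.
  assert (Hlf : ln (f a) <= 4 * s).
  { apply Rle_trans with (ln (a ^ 4)); [now apply ln_le|].
    rewrite ln_pow by lra. simpl. right; unfold s; ring. }
  assert (Hg : exp (eps / 8 * ln (f a)) <= exp (eps / 2 * s)) by (apply exp_monotone; nra).
  set (v := exp (eps / 2 * s)) in *.
  assert (Hv : 0 < v) by apply exp_pos.
  assert (Hwv : w = v * v) by (unfold w, v; rewrite <- exp_plus; f_equal; field).
  assert (Hl2 : 0 < 2 * ln (2 * a) <= 2 * (1 + s)).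
  { rewrite ln_mult by lra. fold s. pose proof (ln_le 2 (exp 1) ltac:(lra)) as E.
    rewrite ln_exp in E. pose proof (exp_ineq1_le 1). pose proof ln_lt_2. lra. }
  assert (H1 : c * w <= v * (2 * ln (2 * a))).
  { apply Rle_trans with (RInt zeta_abs2 a (a + w)); [exact HX|].
    replace (RInt zeta_abs2 a (a + w)) with
      (RInt zeta_abs2 a (a + w) / (2 * ln (2 * a)) * (2 * ln (2 * a))) by (field; lra).
    apply Rmult_le_compat_r; lra. }
  assert (H2 : c * v <= 2 * (1 + s)).
  { apply Rmult_le_reg_l with v; [lra|]. rewrite Hwv in H1. nra. }
  assert (H3 : 4 * (1 + s) <= c * v).
  { replace (4 * (1 + s)) with (c * (4 / c * (1 + s))) by (field; lra).
    apply Rmult_le_compat_l; lra. }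
  lra.
Qed.

(** * Location of the reverse iterates and of the mean-value points *)

Lemma eventually_forall_le (P : nat -> nat -> Prop) (n : nat) :
  (forall r, (r <= n)%nat -> eventually (P r)) ->
  eventually (fun L => forall r, (r <= n)%nat -> P r L).
Proof.
  induction n as [|n IH]; intros H.
  - generalize (H 0%nat (le_n 0)). apply filter_imp. intros L HL r Hr.
    now replace r with 0%nat by lia.
  - generalize (filter_and _ _ (IH (fun r Hr => H r (le_S _ _ Hr))) (H (S n) (le_n _))).
    apply filter_imp. intros L [H1 H2] r Hr.
    destruct (Nat.eq_dec r (S n)) as [->|]; [exact H2|apply H1; lia].
Qed.

(** Induction on [r]. One step back replaces the exponent [eps / 8] by [eps], so the claim has to be
    carried for every [eps]; at [r = 0] the gap is bounded by [U]. *)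
Lemma reverse_iterates_gap (omega f : R -> R) (T0 A U : R) (k0 : nat)
  (a b : nat -> nat -> R) :
  ladder_regular omega f A ->
  (forall B, exists Y, forall T, T0 < T -> Y <= f T -> B < T) ->
  (forall B, eventually (fun L => B < a L 0%nat)) ->
  eventually (fun L => b L 0%nat - a L 0%nat <= U) ->
  (forall r, (r < k0)%nat -> eventually (fun L =>
     T0 < a L (S r) /\ f (a L (S r)) = a L r /\ f (b L (S r)) = b L r)) ->
  forall r, (r <= k0)%nat ->
    (forall B, eventually (fun L => B < a L r)) /\
    (forall eps, 0 < eps <= 1 ->
       eventually (fun L => b L r - a L r <= exp (eps * ln (a L r)))).
Proof.
  intros Hreg Hlarge Ha0 Hb0 Hstep r. induction r as [|r IH]; intros Hr.
  - split; [exact Ha0|]. intros eps He.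
    generalize (filter_and _ _ Hb0 (Ha0 (exp (Rabs U / eps)))).
    apply filter_imp. intros L [H1 H2].
    assert (H3 : Rabs U / eps <= ln (a L 0%nat)).
    { rewrite <- (ln_exp (Rabs U / eps)). apply ln_le; [apply exp_pos|lra]. }
    assert (H4 : Rabs U <= eps * ln (a L 0%nat)).
    { replace (Rabs U) with (eps * (Rabs U / eps)) by (field; lra).
      apply Rmult_le_compat_l; lra. }
    pose proof (exp_ineq1_le (eps * ln (a L 0%nat))). pose proof (Rle_abs U). lra.
  - destruct (IH ltac:(lia)) as [Hlim Hgap]. pose proof (Hstep r ltac:(lia)) as Hs.
    assert (Hlim' : forall B, eventually (fun L => B < a L (S r))).
    { intros B. destruct (Hlarge B) as [Y HY].
      generalize (filter_and _ _ Hs (Hlim Y)). apply filter_imp.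
      intros L [[H1 [H2 _]] H3]. apply HY; [exact H1|]. rewrite H2. lra. }
    split; [exact Hlim'|]. intros eps He.
    destruct (ladder_pullback_gap omega f A eps Hreg He) as [A' HA'].
    generalize (filter_and _ _ (filter_and _ _ Hs (Hlim' A'))
      (filter_and _ _ (Hlim 0) (Hgap (eps / 8) ltac:(lra)))).
    apply filter_imp. intros L [[[_ [H2 H3]] H4] [H5 H6]].
    apply HA'; [lra|lra|]. rewrite H2, H3. exact H6.
Qed.

(** The ladder is monotone beyond [A], so it maps [[a (S r), b (S r)]] into [[a r, b r]]; descend
    from level [k]. *)
Lemma alpha_between (omega f : R -> R) (A d : R) (k : nat) (a b : nat -> R) :
  ladder_regular omega f A ->
  (forall r, (r < k)%nat -> f (a (S r)) = a r /\ f (b (S r)) = b r) ->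
  (forall r, (r <= k)%nat -> A <= a r) ->
  a k <= d <= b k ->
  forall r, (r <= k)%nat -> a r <= alpha f k d r <= b r.
Proof.
  intros Hreg Hs HA Hd.
  assert (H : forall j, (j <= k)%nat -> a (k - j)%nat <= iterf j f d <= b (k - j)%nat).
  { induction j as [|j IH]; intros Hj.
    - rewrite Nat.sub_0_r. exact Hd.
    - specialize (IH ltac:(lia)). destruct (Hs (k - S j)%nat ltac:(lia)) as [H1 H2].
      replace (S (k - S j)) with (k - j)%nat in H1, H2 by lia.
      pose proof (HA (k - j)%nat ltac:(lia)).
      simpl. rewrite <- H1, <- H2.
      split; eapply ladder_monotone; eauto; lra. }
  intros r Hr. unfold alpha.
  specialize (H (k - r)%nat ltac:(lia)).
  now replace (k - (k - r))%nat with r in H by lia.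
Qed.

(** Keeps [U / (b k - a k)] from being a division by zero: the endpoints differ by [U > 0] at level
    0, hence differ at level [k]. *)
Lemma reverse_iterates_inj (f : R -> R) (k : nat) (a b : nat -> R) :
  (forall r, (r < k)%nat -> f (a (S r)) = a r /\ f (b (S r)) = b r) ->
  a k = b k -> a 0%nat = b 0%nat.
Proof.
  induction k as [|k IH]; intros Hs E; [exact E|].
  apply IH; [intros r Hr; apply Hs; lia|].
  destruct (Hs k ltac:(lia)) as [<- <-]. now rewrite E.
Qed.

(** * Quotients of the mean-value identities *)

Lemma is_lim_seq_prod1 (k : nat) (u : nat -> nat -> R) :
  (forall r, (r <= k)%nat -> is_lim_seq (u r) 1) ->
  is_lim_seq (fun L => prod1 k (fun r => u r L)) 1.
Proof.
  induction k as [|k IH]; intros H; simpl; [apply is_lim_seq_const|].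
  replace 1 with (1 * 1) by ring.
  apply is_lim_seq_mult'; [apply IH; intros; apply H; lia|apply H; lia].
Qed.

(** Multiplied out so that the [x r] may vanish. That [y r] is nonzero for [1 <= r <= k] is read off
    from the nonzero product. *)
Lemma prod1_quotient (k : nat) (x y wx wy : nat -> R) :
  (forall r, (r <= k)%nat -> wx r <> 0 /\ wy r <> 0) ->
  prod1 k (fun r => y r / wy r) <> 0 ->
  prod1 k (fun r => x r / y r) * prod1 k (fun r => y r / wy r)
  = prod1 k (fun r => x r / wx r) * prod1 k (fun r => wx r / wy r).
Proof.
  induction k as [|k IH]; intros Hw Hn; simpl in *; [reflexivity|].
  destruct (Hw (S k) (le_n _)) as [Hx Hy].
  assert (H1 : prod1 k (fun r => y r / wy r) <> 0) by (intros E; apply Hn; rewrite E; ring).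
  assert (H2 : y (S k) <> 0) by (intros E; apply Hn; rewrite E; field; assumption).
  specialize (IH (fun r Hr => Hw r (le_S _ _ Hr)) H1).
  set (p := prod1 k (fun r => x r / y r)) in *.
  set (q := prod1 k (fun r => y r / wy r)) in *.
  transitivity (p * q * (x (S k) / wy (S k))); [now field|].
  rewrite IH. now field.
Qed.

(** Dividing the identity for [d] by that for [e] cancels [U / (b k - a k)]. What remains besides
    the zeta quotient is [Q], the product of [omega(alpha_r) / omega(beta_r)]. *)
Lemma ladder_mean_quotient (omega f F : R -> R) (T0 A U : R) (k0 k : nat)
  (a b : nat -> nat -> R) (d e H : nat -> R) :
  ladder_regular omega f A ->
  (forall eta, 0 < eta -> exists A, forall a x y, A <= a ->
    a <= x <= 2 * a -> a <= y <= 2 * a -> Rabs (omega x / omega y - 1) <= eta) ->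
  (forall B, exists Y, forall T, T0 < T -> Y <= f T -> B < T) ->
  (forall B, eventually (fun L => B < a L 0%nat)) ->
  0 < U ->
  eventually (fun L => b L 0%nat - a L 0%nat = U) ->
  (forall r, (r < k0)%nat -> eventually (fun L =>
     T0 < a L (S r) /\ f (a L (S r)) = a L r /\ f (b L (S r)) = b L r)) ->
  (k <= k0)%nat ->
  eventually (fun L => a L k <= d L <= b L k /\
    F (alpha f k (d L) 0) * prod1 k (fun r => Zt2 omega (alpha f k (d L) r))
    = U / (b L k - a L k) * H L) ->
  eventually (fun L => a L k <= e L <= b L k /\
    prod1 k (fun r => Zt2 omega (alpha f k (e L) r)) = U / (b L k - a L k)) ->
  exists Q : nat -> R, is_lim_seq Q 1 /\ eventually (fun L =>
    F (alpha f k (d L) 0) *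
      prod1 k (fun r => zeta_abs2 (alpha f k (d L) r) / zeta_abs2 (alpha f k (e L) r))
    = H L * Q L).
Proof.
  intros Hreg Hratio Hlarge Ha0 HU Hb0 Hstep Hk Hd He.
  assert (Hb0' : eventually (fun L => b L 0%nat - a L 0%nat <= U))
    by (revert Hb0; apply filter_imp; intros; lra).
  pose proof (reverse_iterates_gap omega f T0 A U k0 a b Hreg Hlarge Ha0 Hb0' Hstep) as Hgap.
  assert (Hs : eventually (fun L => forall r, (r < k)%nat ->
     f (a L (S r)) = a L r /\ f (b L (S r)) = b L r)).
  { destruct k as [|k]; [apply filter_forall; intros L r Hr; lia|].
    assert (Hs : eventually (fun L => forall r, (r <= k)%nat ->
      T0 < a L (S r) /\ f (a L (S r)) = a L r /\ f (b L (S r)) = b L r)).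
    { apply (eventually_forall_le (fun r L =>
        T0 < a L (S r) /\ f (a L (S r)) = a L r /\ f (b L (S r)) = b L r)).
      intros r Hr. apply Hstep. lia. }
    revert Hs. apply filter_imp. intros L HL r Hr. apply HL. lia. }
  assert (HA : eventually (fun L => forall r, (r <= k)%nat -> A <= a L r)).
  { apply (eventually_forall_le (fun r L => A <= a L r)). intros r Hr.
    generalize (proj1 (Hgap r ltac:(lia)) A). apply filter_imp. intros; lra. }
  assert (Hbet : eventually (fun L => forall r, (r <= k)%nat ->
    a L r <= alpha f k (d L) r <= b L r /\ a L r <= alpha f k (e L) r <= b L r)).
  { generalize (filter_and _ _ (filter_and _ _ Hs HA) (filter_and _ _ Hd He)).
    apply filter_imp. intros L [[H1 H2] [[H3 _] [H4 _]]] r Hr.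
    split; apply (alpha_between omega f A _ k (a L) (b L)); auto. }
  exists (fun L => prod1 k (fun r =>
    omega (alpha f k (d L) r) / omega (alpha f k (e L) r))).
  split.
  - apply (is_lim_seq_prod1 k (fun r L =>
      omega (alpha f k (d L) r) / omega (alpha f k (e L) r))).
    intros r Hr. apply is_lim_seq_spec. intros eta.
    destruct (Hratio (eta / 2)) as [A' HA']; [apply is_pos_div_2|].
    destruct (Hgap r ltac:(lia)) as [Hlim Hg].
    generalize (filter_and _ _ Hbet (filter_and _ _
      (Hlim (Rmax 0 A')) (Hg 1 ltac:(lra)))).
    apply filter_imp. intros L [H1 [H2 H3]].
    destruct (H1 r Hr) as [H4 H5].
    pose proof (Rmax_l 0 A'). pose proof (Rmax_r 0 A').
    (* With exponent 1 the gap bound reads [b L r - a L r <= a L r], so both points lie in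
       [[a L r, 2 a L r]], as [Hratio] requires. *)
    rewrite Rmult_1_l, exp_ln in H3 by lra.
    apply Rle_lt_trans with (eta / 2); [|pose proof (cond_pos eta); lra].
    apply (HA' (a L r)); lra.
  - generalize (filter_and _ _ (filter_and _ _ Hbet HA)
      (filter_and _ _ (filter_and _ _ Hs Hb0) (filter_and _ _ Hd He))).
    apply filter_imp. intros L [[H1 H2] [[H3 H4] [[_ H5] [_ H6]]]].
    set (V := U / (b L k - a L k)) in *.
    assert (HV : V <> 0).
    { unfold V. apply Rmult_integral_contrapositive_currified; [lra|].
      apply Rinv_neq_0_compat. intros E.
      pose proof (reverse_iterates_inj f k (a L) (b L) H3 ltac:(lra)). lra. }
    assert (Hw : forall x, A <= x -> omega x <> 0).
    { intros x Hx. destruct (Hreg x Hx) as [_ [Hl [_ [Ho _]]]]. lra. }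
    pose proof (prod1_quotient k
      (fun r => zeta_abs2 (alpha f k (d L) r)) (fun r => zeta_abs2 (alpha f k (e L) r))
      (fun r => omega (alpha f k (d L) r)) (fun r => omega (alpha f k (e L) r))) as HQ.
    cbv beta in HQ. unfold Zt2 in H5, H6. rewrite H6 in HQ.
    assert (HQ' := HQ ltac:(intros r Hr; destruct (H1 r Hr); pose proof (H2 r Hr);
      split; apply Hw; lra) HV).
    apply Rmult_eq_reg_r with V; [|exact HV].
    rewrite Rmult_assoc, HQ', <- Rmult_assoc, H5. ring.
Qed.

(** * The mean values of the three weights *)

(** All three weights have period [PI], so their means over the moving interval do not depend on
    [L]. *)
Lemma Hmean_periodic (f : R -> R) (x U : R) (L : nat) :
  ex_RInt f x (x + U) ->
  (forall y, f (y + PI) = f y) ->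
  Hmean (PI * INR L + x) U f = Hmean x U f.
Proof.
  intros Hf Hper. unfold Hmean. f_equal. apply is_RInt_unique.
  assert (HperL : forall y, f (y + PI * INR L) = f y).
  { induction L as [|L IH]; intros y.
    - simpl. f_equal. ring.
    - rewrite S_INR.
      replace (y + PI * (INR L + 1)) with (y + PI * INR L + PI) by ring.
      now rewrite Hper. }
  apply is_RInt_ext with (fun y => scal 1 (f (1 * y + - (PI * INR L)))).
  - intros y _. change (1 * f (1 * y + - (PI * INR L)) = f y).
    rewrite Rmult_1_l, <- HperL. f_equal. ring.
  - apply (is_RInt_comp_lin f 1 (- (PI * INR L))).
    replace (1 * (PI * INR L + x) + - (PI * INR L)) with x by ring.
    replace (1 * (PI * INR L + x + U) + - (PI * INR L)) with (x + U) by ring.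
    now apply (RInt_correct f).
Qed.

Lemma Hmean_primitive (f F : R -> R) (x U : R) :
  0 <= U ->
  (forall t, x <= t <= x + U -> is_derive F t (f t)) ->
  (forall t, x <= t <= x + U -> continuous f t) ->
  (forall y, f (y + PI) = f y) ->
  forall L, Hmean (PI * INR L + x) U f = (F (x + U) - F x) / U.
Proof.
  intros HU HF Hf Hper L.
  assert (HF' : forall t, Rmin x (x + U) <= t <= Rmax x (x + U) -> is_derive F t (f t))
    by (rewrite Rmin_left, Rmax_right by lra; exact HF).
  assert (Hf' : forall t, Rmin x (x + U) <= t <= Rmax x (x + U) -> continuous f t)
    by (rewrite Rmin_left, Rmax_right by lra; exact Hf).
  rewrite Hmean_periodic; [|now apply (ex_RInt_continuous (V := R_CompleteNormedModule))|exact Hper].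
  unfold Hmean. rewrite (RInt_sub_primitive f F x (x + U) HF' Hf'). apply Rmult_comm.
Qed.

Lemma Hmean_fsin2 (x U : R) (L : nat) : 0 <= U ->
  Hmean (PI * INR L + x) U fsin2
  = (U - (sin (x + U) * cos (x + U) - sin x * cos x)) / 2 / U.
Proof.
  intros HU. rewrite (Hmean_primitive fsin2 (fun t => (t - sin t * cos t) / 2)); try assumption.
  - unfold Rdiv. ring.
  - intros t _. unfold fsin2. auto_derive; [trivial|]. pose proof (sin2_cos2 t).
    unfold Rsqr in *. lra.
  - intros t _. apply (ex_derive_continuous fsin2). unfold fsin2. auto_derive. trivial.
  - intros y. unfold fsin2. rewrite neg_sin. ring.
Qed.

Lemma Hmean_fcos2 (x U : R) (L : nat) : 0 <= U ->
  Hmean (PI * INR L + x) U fcos2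
  = (U + (sin (x + U) * cos (x + U) - sin x * cos x)) / 2 / U.
Proof.
  intros HU. rewrite (Hmean_primitive fcos2 (fun t => (t + sin t * cos t) / 2)); try assumption.
  - unfold Rdiv. ring.
  - intros t _. unfold fcos2. auto_derive; [trivial|]. pose proof (sin2_cos2 t).
    unfold Rsqr in *. lra.
  - intros t _. apply (ex_derive_continuous fcos2). unfold fcos2. auto_derive. trivial.
  - intros y. unfold fcos2. rewrite neg_cos. ring.
Qed.

Lemma Hmean_finvcos2 (x U : R) (L : nat) : 0 <= U ->
  (forall t, x <= t <= x + U -> cos t <> 0) ->
  Hmean (PI * INR L + x) U finvcos2
  = (sin (x + U) / cos (x + U) - sin x / cos x) / U.
Proof.
  intros HU Hc. apply (Hmean_primitive finvcos2 (fun t => sin t / cos t)); try assumption.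
  - intros t Ht. specialize (Hc t Ht). unfold finvcos2. auto_derive; [assumption|].
    pose proof (sin2_cos2 t) as E. unfold Rsqr in E.
    transitivity ((sin t * sin t + cos t * cos t) / cos t ^ 2); [now field|now rewrite E].
  - intros t Ht. specialize (Hc t Ht). apply (ex_derive_continuous finvcos2).
    unfold finvcos2. auto_derive. rewrite Rmult_1_r. now apply Rmult_integral_contrapositive_currified.
  - intros y. unfold finvcos2. rewrite neg_cos. f_equal. ring.
Qed.

(** * The identity between the three means and the passage to the limit *)

Theorem theorem2
  (mu_fun : R -> R) (phi : R -> R) (omega : R -> R) (T0 : R)
  (* mu(y) > 7 y ln y *)
  (Hmu : forall y, 0 < y -> 7 * y * ln y < mu_fun y)
  (* phi is a solution of the Jacob's ladder integral equation *)
  (Hphi : forall T, T0 < T -> jacob_eq mu_fun phi T)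
  (* omega(t) = {1 + O(ln ln t / ln t)} ln t *)
  (Homega : exists C t1, forall t, t1 <= t ->
       Rabs (omega t / ln t - 1) <= C * (ln (ln t) / ln t))
  (* tilde Z^2 = d phi_1 / dt, phi_1 = phi / 2 *)
  (Hder : forall t, T0 < t -> is_derive (fun x => phi x / 2) t (Zt2 omega t))
  (U U0 mu mu0 eps : R) (k0 k1 k2 k3 : nat)
  (HU : 0 < U) (HUU0 : U <= U0) (Hmu0 : 0 < mu0) (Hmumu0 : mu0 <= mu)
  (Heps : 0 < eps) (Hangle : 2 * mu + U0 <= PI / 2 - eps)
  (Hk1 : (1 <= k1 <= k0)%nat) (Hk2 : (1 <= k2 <= k0)%nat)
  (Hk3 : (1 <= k3 <= k0)%nat)
  (* reverse iterations T^{(r)} and (T+U)^{(r)}, T = pi L + mu *)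
  (TT TU : nat -> nat -> R)
  (HTT0 : forall L, T0 < PI * INR L -> TT L O = PI * INR L + mu)
  (HTU0 : forall L, T0 < PI * INR L -> TU L O = PI * INR L + mu + U)
  (HTTS : forall L r, T0 < PI * INR L -> (r < k0)%nat ->
       T0 < TT L (S r) /\ phi (TT L (S r)) / 2 = TT L r)
  (HTUS : forall L r, T0 < PI * INR L -> (r < k0)%nat ->
       T0 < TU L (S r) /\ phi (TU L (S r)) / 2 = TU L r)
  (* mean-value points d (for f = sin^2, cos^2, 1/cos^2) and e *)
  (d1 d2 d3 e1 e2 e3 : nat -> R)
  (Hd1 : forall L, T0 < PI * INR L ->
       TT L k1 <= d1 L <= TU L k1 /\
       fsin2 (alpha (fun x => phi x / 2) k1 (d1 L) 0)
       * prod1 k1 (fun r => Zt2 omega (alpha (fun x => phi x / 2) k1 (d1 L) r))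
       = U / (TU L k1 - TT L k1) * Hmean (PI * INR L + mu) U fsin2)
  (Hd2 : forall L, T0 < PI * INR L ->
       TT L k2 <= d2 L <= TU L k2 /\
       fcos2 (alpha (fun x => phi x / 2) k2 (d2 L) 0)
       * prod1 k2 (fun r => Zt2 omega (alpha (fun x => phi x / 2) k2 (d2 L) r))
       = U / (TU L k2 - TT L k2) * Hmean (PI * INR L + mu) U fcos2)
  (Hd3 : forall L, T0 < PI * INR L ->
       TT L k3 <= d3 L <= TU L k3 /\
       finvcos2 (alpha (fun x => phi x / 2) k3 (d3 L) 0)
       * prod1 k3 (fun r => Zt2 omega (alpha (fun x => phi x / 2) k3 (d3 L) r))
       = U / (TU L k3 - TT L k3) * Hmean (PI * INR L + mu) U finvcos2)
  (He1 : forall L, T0 < PI * INR L ->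
       TT L k1 <= e1 L <= TU L k1 /\
       prod1 k1 (fun r => Zt2 omega (alpha (fun x => phi x / 2) k1 (e1 L) r))
       = U / (TU L k1 - TT L k1))
  (He2 : forall L, T0 < PI * INR L ->
       TT L k2 <= e2 L <= TU L k2 /\
       prod1 k2 (fun r => Zt2 omega (alpha (fun x => phi x / 2) k2 (e2 L) r))
       = U / (TU L k2 - TT L k2))
  (He3 : forall L, T0 < PI * INR L ->
       TT L k3 <= e3 L <= TU L k3 /\
       prod1 k3 (fun r => Zt2 omega (alpha (fun x => phi x / 2) k3 (e3 L) r))
       = U / (TU L k3 - TT L k3)) :
  is_lim_seq
    (fun L : nat =>
       prod1 k3 (fun r =>
         zeta_abs2 (alpha (fun x => phi x / 2) k3 (d3 L) r)
         / zeta_abs2 (alpha (fun x => phi x / 2) k3 (e3 L) r))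
       /
       ( cos (alpha (fun x => phi x / 2) k2 (d2 L) 0) ^ 2
         * cos (alpha (fun x => phi x / 2) k3 (d3 L) 0) ^ 2
         / (cos (2 * mu + U) * cos (mu + U) * cos mu)
         * prod1 k2 (fun r =>
             zeta_abs2 (alpha (fun x => phi x / 2) k2 (d2 L) r)
             / zeta_abs2 (alpha (fun x => phi x / 2) k2 (e2 L) r))
       - sin (alpha (fun x => phi x / 2) k1 (d1 L) 0) ^ 2
         * cos (alpha (fun x => phi x / 2) k3 (d3 L) 0) ^ 2
         / (cos (2 * mu + U) * cos (mu + U) * cos mu)
         * prod1 k1 (fun r =>
             zeta_abs2 (alpha (fun x => phi x / 2) k1 (d1 L) r)
             / zeta_abs2 (alpha (fun x => phi x / 2) k1 (e1 L) r))))
    1.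
Proof.
  assert (Hcos : forall t, 0 <= t <= 2 * mu + U -> 0 < cos t)
    by (intros t Ht; apply cos_gt_0; pose proof PI_RGT_0; lra).
  assert (HsinU : 0 < sin U) by (apply sin_gt_0; pose proof PI_RGT_0; lra).
  set (f := fun x => phi x / 2) in *.
  destruct (omega_equiv_ln omega Homega (/ 2) ltac:(lra)) as [A0 [HA0 HA]].
  assert (Hreg : ladder_regular omega f (Rmax A0 (T0 + 1))).
  { intros t Ht. pose proof (Rmax_l A0 (T0 + 1)). pose proof (Rmax_r A0 (T0 + 1)).
    assert (1 <= ln t) by (rewrite <- (ln_exp 1); apply ln_le; [apply exp_pos|lra]).
    pose proof (HA t ltac:(lra)) as B. apply Rabs_le_between in B.
    pose proof (exp_ineq1_le 1).
    split; [apply Hder; lra|]. repeat split; lra. }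
  pose proof (omega_ratio omega (omega_equiv_ln omega Homega)) as Hratio.
  pose proof (ladder_arg_large mu_fun phi T0 Hmu Hphi) as Hlarge.
  change (forall B, exists Y, forall T, T0 < T -> Y <= f T -> B < T) in Hlarge.
  assert (HPI : forall B, eventually (fun L => B < PI * INR L)).
  { intros B. destruct (INR_archimed PI B PI_RGT_0) as [N HN].
    exists N. intros n Hn. apply le_INR in Hn. pose proof PI_RGT_0. nra. }
  assert (HL := HPI T0).
  assert (Ha0 : forall B, eventually (fun L => B < TT L 0%nat)).
  { intros B. generalize (filter_and _ _ HL (HPI B)). apply filter_imp.
    intros L [H1 H2]. rewrite HTT0 by exact H1. lra. }
  assert (Hb0 : eventually (fun L => TU L 0%nat - TT L 0%nat = U)).
  { revert HL. apply filter_imp. intros L H1. rewrite HTT0, HTU0 by exact H1. ring. }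
  assert (Hstep : forall r, (r < k0)%nat -> eventually (fun L =>
     T0 < TT L (S r) /\ f (TT L (S r)) = TT L r /\ f (TU L (S r)) = TU L r)).
  { intros r Hr. revert HL. apply filter_imp. intros L H1.
    destruct (HTTS L r H1 Hr). destruct (HTUS L r H1 Hr). auto. }
  assert (key : forall F k d e, (k <= k0)%nat ->
    (forall L, T0 < PI * INR L -> TT L k <= d L <= TU L k /\
       F (alpha f k (d L) 0%nat) * prod1 k (fun r => Zt2 omega (alpha f k (d L) r))
       = U / (TU L k - TT L k) * Hmean (PI * INR L + mu) U F) ->
    (forall L, T0 < PI * INR L -> TT L k <= e L <= TU L k /\
       prod1 k (fun r => Zt2 omega (alpha f k (e L) r)) = U / (TU L k - TT L k)) ->
    exists Q : nat -> R, is_lim_seq Q 1 /\ eventually (fun L =>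
      F (alpha f k (d L) 0%nat) * prod1 k (fun r =>
        zeta_abs2 (alpha f k (d L) r) / zeta_abs2 (alpha f k (e L) r))
      = Hmean (PI * INR L + mu) U F * Q L)).
  { intros F k d e Hk Hd He.
    apply (ladder_mean_quotient omega f F T0 (Rmax A0 (T0 + 1)) U k0 k TT TU d e
             (fun L => Hmean (PI * INR L + mu) U F)); auto;
      revert HL; apply filter_imp; assumption. }
  destruct (key fsin2 k1 d1 e1 (proj2 Hk1) Hd1 He1) as [Q1 [HQ1 E1]].
  destruct (key fcos2 k2 d2 e2 (proj2 Hk2) Hd2 He2) as [Q2 [HQ2 E2]].
  destruct (key finvcos2 k3 d3 e3 (proj2 Hk3) Hd3 He3) as [Q3 [HQ3 E3]].
  set (P := cos (2 * mu + U) * cos (mu + U) * cos mu).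
  set (h1 := (U - (sin (mu + U) * cos (mu + U) - sin mu * cos mu)) / 2 / U).
  set (h2 := (U + (sin (mu + U) * cos (mu + U) - sin mu * cos mu)) / 2 / U).
  set (h3 := (sin (mu + U) / cos (mu + U) - sin mu / cos mu) / U).
  assert (P1 : 0 < cos (2 * mu + U)) by (apply Hcos; lra).
  assert (P2 : 0 < cos (mu + U)) by (apply Hcos; lra).
  assert (P3 : 0 < cos mu) by (apply Hcos; lra).
  assert (ES : sin U = sin (mu + U) * cos mu - cos (mu + U) * sin mu).
  { rewrite <- sin_minus. f_equal. ring. }
  assert (Eh21 : h2 - h1 = cos (2 * mu + U) * sin U / U).
  { unfold h1, h2. replace (2 * mu + U) with (mu + (mu + U)) by ring.
    rewrite ES, (cos_plus mu (mu + U)).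
    pose proof (sin2_cos2 mu) as S1. pose proof (sin2_cos2 (mu + U)) as S2.
    unfold Rsqr in S1, S2.
    set (s := sin mu) in *. set (c := cos mu) in *.
    set (s' := sin (mu + U)) in *. set (c' := cos (mu + U)) in *.
    (* Made homogeneous by [sin^2 + cos^2 = 1], the numerator factors as
       [(c c' - s s') (s' c - c' s)]. *)
    transitivity ((s' * c' * (s * s + c * c) - s * c * (s' * s' + c' * c')) / U).
    - rewrite S1, S2. field. lra.
    - field. lra. }
  assert (Eh3 : h3 = sin U / (cos (mu + U) * cos mu) / U).
  { unfold h3. rewrite ES. field. lra. }
  (* The elementary identity behind the asymptotic formula; it makes the limit equal to 1. *)
  assert (Eh : h3 * P = h2 - h1) by (rewrite Eh21, Eh3; unfold P; field; lra).
  assert (Hh : 0 < h2 - h1).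
  { rewrite Eh21. apply Rdiv_lt_0_compat; [apply Rmult_lt_0_compat|]; assumption. }
  assert (Hh3 : h3 <> 0) by (intros E; rewrite E in Eh; lra).
  assert (HQ3nz : eventually (fun L => Q3 L <> 0)).
  { apply is_lim_seq_spec in HQ3. generalize (HQ3 (mkposreal 1 Rlt_0_1)).
    apply filter_imp. simpl. intros L H1 H0. rewrite H0 in H1.
    rewrite Rminus_0_l, Rabs_Ropp, Rabs_R1 in H1. lra. }
  (* Inserting the three mean-value quotients, [cos^2(alpha_0^{3,3})] cancels and only constants and
     the [Q] factors remain. *)
  apply is_lim_seq_ext_loc with (fun L => h3 * P * Q3 L / (h2 * Q2 L - h1 * Q1 L)).
  - generalize (filter_and _ _ (filter_and _ _ E1 E2) (filter_and _ _ E3 HQ3nz)).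
    apply filter_imp. intros L [[F1 F2] [F3 F4]].
    rewrite Hmean_fsin2 in F1 by lra. rewrite Hmean_fcos2 in F2 by lra.
    rewrite Hmean_finvcos2 in F3 by (first [lra|intros t Ht; apply Rgt_not_eq, Hcos; lra]).
    fold h1 in F1. fold h2 in F2. fold h3 in F3.
    unfold fsin2 in F1. unfold fcos2 in F2. unfold finvcos2 in F3.
    set (c3 := cos (alpha f k3 (d3 L) 0) ^ 2) in *.
    (* Were [c3] zero, [1 / c3] would be 0 by convention and the left side of [F3] would vanish,
       against [h3 * Q3 L <> 0]. *)
    assert (Hc3 : c3 <> 0).
    { intros E. rewrite E in F3. unfold Rdiv in F3 at 1. rewrite Rinv_0 in F3.
      assert (h3 * Q3 L <> 0) by (now apply Rmult_integral_contrapositive_currified).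
      lra. }
    set (A1 := prod1 k1 _) in *. set (A2 := prod1 k2 _) in *. set (A3 := prod1 k3 _) in *.
    clearbody A1 A2 A3 c3.
    replace A3 with (c3 * (h3 * Q3 L)) by (rewrite <- F3; field; assumption).
    rewrite <- F1, <- F2.
    set (x1 := sin _ ^ 2). set (x2 := cos (alpha f k2 (d2 L) 0) ^ 2).
    replace (x2 * c3 / P * A2 - x1 * c3 / P * A1) with (c3 * / P * (x2 * A2 - x1 * A1))
      by (unfold Rdiv; ring).
    unfold Rdiv. rewrite !Rinv_mult, Rinv_inv.
    (* Both sides contain the same inverse, which [field] treats as an atom. *)
    set (y := / (x2 * A2 - x1 * A1)). now field.
  - replace 1 with (h3 * P * 1 / (h2 * 1 - h1 * 1)) by (rewrite Eh; field; lra).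
    apply is_lim_seq_div'.
    + apply (is_lim_seq_scal_l Q3 (h3 * P) 1), HQ3.
    + apply is_lim_seq_minus'.
      * apply (is_lim_seq_scal_l Q2 h2 1), HQ2.
      * apply (is_lim_seq_scal_l Q1 h1 1), HQ1.
    + lra.
Qed.
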